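(* Let $R>0$ and $\alpha\in(0,\pi/2)$, let $\Omega\subset\mathbb{R}^N$ be a funnel-shaped domain with parameters $(R,\alpha)$, and let $u$ be the front-like solution in $\Omega$. Assume that $u$ is blocked, i.e. $u(t,x)\to u_\infty(x)$ as $t\to+\infty$ locally uniformly in $x\in\overline\Omega$, with $u_\infty(x)\to0$ as $x_1\to+\infty$. Then $u$ is a transition front connecting $1$ and $0$ without any global mean speed, and the sets $(\Gamma_t)_{t\in\mathbb{R}}$, $(\Omega^\pm_t)_{t\in\mathbb{R}}$ in the definition of transition front can be defined by $$\Gamma_t=\{x\in\Omega:x_1=ct\}\ \text{ and }\ \Omega^\pm_t=\{x\in\Omega:\pm(x_1-ct)<0\}\quad\text{for } t\le0,$$ $$\Gamma_t=\{x\in\Omega:x_1=0\}\ \text{ and }\ \Omega^\pm_t=\{x\in\Omega:\pm x_1<0\}\quad\text{for } t>0.$$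
   Context: Nonlinearity and planar front. $N\ge 2$ is an integer. $f\in C^{1,1}([0,1],\mathbb{R})$ satisfies $f(0)=f(1)=0$, $f'(0)<0$, $f'(1)<0$, and there is $\theta\in(0,1)$ such that $f<0$ in $(0,\theta)$, $f>0$ in $(\theta,1)$, $f'(\theta)>0$ and $\int_0^1 f(s)\,ds>0$. It is extended to $\mathbb{R}$ by $f(s)=f'(0)s$ for $s<0$ and $f(s)=f'(1)(s-1)$ for $s>1$. Under these assumptions there are a unique speed $c$ and a unique profile $\phi:\mathbb{R}\to\mathbb{R}$ with $\phi''+c\phi'+f(\phi)=0$ in $\mathbb{R}$, $\phi(-\infty)=1$, $\phi(+\infty)=0$, $0<\phi<1$ and $\phi(0)=\theta$; moreover $c>0$ and $\phi'<0$. Funnel-shaped domain. Points are written $x=(x_1,x')\in\mathbb{R}\times\mathbb{R}^{N-1}$. A funnel-shaped domain with parameters $R>0$, $\alpha\in(0,\pi/2)$ is a set $\Omega=\{x=(x_1,x')\in\mathbb{R}^N: x_1\in\mathbb{R},\ |x'|<h(x_1)\}$, where $h:\mathbb{R}\to(0,+\infty)$ is of class $C^{2,\beta}(\mathbb{R})$ (for some $0<\beta<1$), $0\le h'\le\tan\alpha$ in $\mathbb{R}$, $h=R$ in $(-\infty,0]$, and $h(x_1)=x_1\tan\alpha$ in $[L\cos\alpha,+\infty)$ for some $L>R$. $\nu$ is the outward unit normal on $\partial\Omega$. $d_\Omega$ is the geodesic distance in $\overline\Omega$; distances between sets (or a point and a set) are the infima of the distances between their points. Front-like solution. The front-like solution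 in $\Omega$ is the unique entire (defined for all $t\in\mathbb{R}$) classical solution $u:\mathbb{R}\times\overline\Omega\to[0,1]$ of $u_t=\Delta u+f(u)$ in $\mathbb{R}\times\overline\Omega$, $\nu\cdot\nabla u=0$ on $\mathbb{R}\times\partial\Omega$, such that $u(t,x)-\phi(x_1-ct)\to0$ as $t\to-\infty$ uniformly in $x\in\overline\Omega$. It exists, is unique, satisfies $0<u<1$ and $u_t>0$, and converges as $t\to+\infty$ in $C^2_{loc}(\overline\Omega)$ to some $u_\infty$ with $0<u_\infty\le1$. Transition front. A transition front connecting $1$ and $0$ is a classical solution $u:\mathbb{R}\times\overline\Omega\to(0,1)$ of $u_t=\Delta u+f(u)$ in $\mathbb{R}\times\overline\Omega$, $\nu\cdot\nabla u=0$ on $\mathbb{R}\times\partial\Omega$, for which there exist families $(\Omega^-_t)_{t\in\mathbb{R}}$, $(\Omega^+_t)_{t\in\mathbb{R}}$ of open non-empty subsets of $\Omega$ and sets $(\Gamma_t)_{t\in\mathbb{R}}$ such that: (a) for every $t$: $\Omega^-_t\cap\Omega^+_t=\emptyset$, $\partial\Omega^-_t\cap\Omega=\partial\Omega^+_t\cap\Omega=\Gamma_t\ne\emptyset$, $\Omega^-_t\cup\Gamma_t\cup\Omega^+_t=\Omega$, and $\sup\{d_\Omega(x,\Gamma_t):x\in\Omega^+_t\}=\sup\{d_\Omega(x,\Gamma_t):x\in\Omega^-_t\}=+\infty$; (b) for each sign $\pm$, $\inf\{\sup\{d_\Omega(y,\Gamma_t):y\in\Omega^\pm_t,\ d_\Omega(y,x)\le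 r\}:t\in\mathbb{R},\ x\in\Gamma_t\}\to+\infty$ as $r\to+\infty$; (c) there is an integer $n\ge1$ such that for each $t\in\mathbb{R}$ there are $n$ open subsets $\omega_{i,t}\subset\mathbb{R}^{N-1}$, $n$ continuous maps $\psi_{i,t}:\omega_{i,t}\to\mathbb{R}$ and $n$ rotations $R_{i,t}$ of $\mathbb{R}^N$ ($1\le i\le n$) with $\Gamma_t\subset\bigcup_{1\le i\le n}R_{i,t}(\{(y',y_N)\in\mathbb{R}^{N-1}\times\mathbb{R}:y'\in\omega_{i,t},\ y_N=\psi_{i,t}(y')\})$; (d) for every $\varepsilon>0$ there is $M_\varepsilon>0$ such that for all $t\in\mathbb{R}$: $x\in\overline{\Omega^+_t}$ and $d_\Omega(x,\Gamma_t)\ge M_\varepsilon$ imply $u(t,x)\ge1-\varepsilon$; and $x\in\overline{\Omega^-_t}$ and $d_\Omega(x,\Gamma_t)\ge M_\varepsilon$ imply $u(t,x)\le\varepsilon$. It has global mean speed $\gamma\in[0,+\infty)$ if $d_\Omega(\Gamma_t,\Gamma_s)/|t-s|\to\gamma$ as $|t-s|\to+\infty$ (whether a global mean speed exists, and its value, do not depend on the choice of the families). *)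

(* Defs.v *)
From HB Require Import structures.
From mathcomp Require Import all_boot all_order all_algebra.
From mathcomp Require Import all_classical all_reals all_analysis.
Set Implicit Arguments.
Unset Strict Implicit.
Unset Printing Implicit Defensive.
Import Order.TTheory GRing.Theory Num.Theory.
Import numFieldNormedType.Exports.
Local Open Scope classical_set_scope.
Local Open Scope ring_scope.

(* The space R^N with N = n + 1 is 'rV[R]_n.+1; x_1 is the entry of index 0   *)
(* and x' = (x_2, ..., x_N) the entries of positive index.  The library norm  *)
(* of 'rV[R]_n.+1 is the sup norm; it induces the usual topology, but lengths *)
(* are measured with the Euclidean norm [enorm].                              *)
Section Space.
Variables (R : realType) (n : nat).
Notation V := 'rV[R]_n.+1.

Definition edot (k : nat) (x y : 'rV[R]_k) : R := \sum_i x 0 i * y 0 i.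

Definition enorm (k : nat) (x : 'rV[R]_k) : R := Num.sqrt (edot x x).

Definition fstc (x : V) : R := x 0 ord0.

Definition sndc (x : V) : 'rV[R]_n := \row_i x 0 (lift ord0 i).

Definition basis_vec (i : 'I_n.+1) : V := delta_mx 0 i.

Definition bdry (A : set V) : set V := closure A `\` interior A.

(* Length of g : [0, 1] -> R^N, as a supremum over the subdivisions           *)
(* 0 < s_1 < ... < s_k = 1; compare [variation] and [total_variation].        *)
Definition polygon_length (g : R -> V) (s : seq R) : R :=
  let F := g \o nth 1 (0 :: s) in \sum_(i < size s) enorm (F i.+1 - F i).

Definition path_length (g : R -> V) : \bar R :=
  ereal_sup [set (polygon_length g s)%:E | s in itv_partition 0 1].

Definition path_in (A : set V) (x y : V) (g : R -> V) : Prop :=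
  [/\ {within `[0, 1], continuous g}, g 0 = x, g 1 = y &
      forall s : R, 0 <= s <= 1 -> A (g s)].

Definition geo_dist (Omega : set V) (x y : V) : \bar R :=
  ereal_inf [set path_length g | g in path_in (closure Omega) x y].

Definition geo_dist_set (Omega : set V) (x : V) (B : set V) : \bar R :=
  ereal_inf [set geo_dist Omega x y | y in B].

Definition geo_dist_sets (Omega A B : set V) : \bar R :=
  ereal_inf [set geo_dist_set Omega x B | x in A].

End Space.

Section Nonlinearity.
Variable R : realType.

(* [f] is the nonlinearity already extended affinely outside [0, 1]; thanks   *)
(* to this extension its two-sided derivatives at 0 and 1 are the one-sided   *)
(* derivatives of its restriction to [0, 1], which is then of class C^{1,1}.  *)
Definition bistable (f : R -> R) (theta : R) : Prop :=
  [/\ (forall s : R, 0 <= s <= 1 -> derivable f s 1) /\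
      (exists k : R, k.-lipschitz_`[0, 1] (derive1 f)),
      [/\ f 0 = 0, f 1 = 0, derive1 f 0 < 0 & derive1 f 1 < 0],
      [/\ 0 < theta < 1,
          forall s : R, 0 < s < theta -> f s < 0,
          forall s : R, theta < s < 1 -> 0 < f s &
          0 < derive1 f theta],
      0 < \int[lebesgue_measure]_(s in `[0, 1]) f s &
      (forall s : R, s < 0 -> f s = derive1 f 0 * s) /\
      (forall s : R, 1 < s -> f s = derive1 f 1 * (s - 1))].

Definition planar_front (f : R -> R) (theta c : R) (phi : R -> R) : Prop :=
  [/\ forall s : R, derivable phi s 1 /\ derivable (derive1 phi) s 1,
      forall s : R, derive1n 2 phi s + c * derive1 phi s + f (phi s) = 0,
      phi x @[x --> -oo] --> (1 : R) /\ phi x @[x --> +oo] --> (0 : R),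
      forall s : R, 0 < phi s < 1 &
      phi 0 = theta].

End Nonlinearity.

Section Funnel.
Variables (R : realType) (n : nat).
Notation V := 'rV[R]_n.+1.

(* The Hölder condition on h'' is global, which costs nothing: h'' vanishes   *)
(* outside a compact interval.                                                *)
Definition funnel_profile (rad alpha : R) (h : R -> R) : Prop :=
  [/\ [/\ forall s : R, derivable h s 1,
          forall s : R, derivable (derive1 h) s 1 &
          exists2 beta : R, 0 < beta < 1 &
          exists C : R, forall s t : R,
            `|derive1n 2 h s - derive1n 2 h t| <= C * (`|s - t| `^ beta)],
      forall s : R, 0 < h s,
      forall s : R, 0 <= derive1 h s <= tan alpha,
      forall s : R, s <= 0 -> h s = rad &
      exists2 L : R, rad < L &
        forall s : R, L * cos alpha <= s -> h s = s * tan alpha].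

Definition funnel (h : R -> R) : set V :=
  [set x | enorm (sndc x) < h (fstc x)].

(* Normalized gradient of |x'| - h(x_1), which is negative exactly in the     *)
(* funnel.                                                                    *)
Definition outward_normal (h : R -> R) (x : V) : V :=
  (Num.sqrt (1 + derive1 h (fstc x) ^+ 2))^-1 *:
  \row_i (if i == ord0 then - derive1 h (fstc x)
          else x 0 i / enorm (sndc x)).

(* u is of class C^1 in t and C^2 in x up to the boundary: ut, Du and D2u are *)
(* the continuous extensions to R x closure Omega of the derivatives of u in  *)
(* R x Omega.  Values of u outside R x closure Omega are irrelevant.          *)
Definition classical_solution (f : R -> R) (h : R -> R) (u : R -> V -> R) :
    Prop :=
  let Omega := funnel h in
  let Q := [set p : R * V | closure Omega p.2] in
  exists (ut : R -> V -> R) (Du : R -> V -> V) (D2u : R -> V -> 'M[R]_n.+1),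
  [/\ [/\ {within Q, continuous (fun p : R * V => u p.1 p.2)},
          {within Q, continuous (fun p : R * V => ut p.1 p.2)},
          {within Q, continuous (fun p : R * V => Du p.1 p.2)} &
          {within Q, continuous (fun p : R * V => D2u p.1 p.2)}],
      [/\ forall (t : R) (x : V), Omega x -> is_derive t 1 (fun s : R => u s x) (ut t x),
          forall t x i, Omega x ->
            is_derive x (basis_vec R i) (u t) (Du t x 0 i) &
          forall t x i j, Omega x ->
            is_derive x (basis_vec R j) (fun y => Du t y 0 i) (D2u t x i j)],
      forall (t : R) (x : V), closure Omega x -> ut t x = \tr (D2u t x) + f (u t x) &
      forall (t : R) (x : V), bdry Omega x -> edot (outward_normal h x) (Du t x) = 0].

Definition front_like_solution (f : R -> R) (c : R) (phi : R -> R)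
    (h : R -> R) (u : R -> V -> R) : Prop :=
  [/\ classical_solution f h u,
      forall (t : R) (x : V), closure (funnel h) x -> 0 <= u t x <= 1 &
      forall eps : R, 0 < eps -> \forall t \near -oo,
        forall x : V, closure (funnel h) x ->
          `|u t x - phi (fstc x - c * t)| <= eps].

Definition blocked (h : R -> R) (u : R -> V -> R) : Prop :=
  exists uinf : V -> R,
    (forall K : set V, compact K -> K `<=` closure (funnel h) ->
       forall eps : R, 0 < eps -> \forall t \near +oo,
         forall x : V, K x -> `|u t x - uinf x| <= eps) /\
    (forall eps : R, 0 < eps -> exists A : R,
       forall x : V, closure (funnel h) x -> A <= fstc x -> `|uinf x| <= eps).

End Funnel.

Section TransitionFront.
Variables (R : realType) (n : nat).
Notation V := 'rV[R]_n.+1.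

Definition rotation (Q : 'M[R]_n.+1) : Prop := Q *m Q^T = 1%:M /\ \det Q = 1.

(* Graph of psi over omega, in the last coordinate y_N of y = (y', y_N).      *)
Definition graph_of (omega : set 'rV[R]_n) (psi : 'rV[R]_n -> R) : set V :=
  [set y : V | let y' := \row_i y 0 (widen_ord (leqnSn n) i) in
               omega y' /\ y 0 ord_max = psi y'].

(* [Om], [Op] and [G] stand for the families Omega^-, Omega^+ and Gamma.      *)
Definition front_partition (Omega : set V) (Om Op G : R -> set V) : Prop :=
  forall t,
  [/\ [/\ open (Om t), Om t !=set0 & Om t `<=` Omega],
      [/\ open (Op t), Op t !=set0 & Op t `<=` Omega],
      [/\ Om t `&` Op t = set0, bdry (Om t) `&` Omega = G t,
          bdry (Op t) `&` Omega = G t, G t !=set0 &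
          Om t `|` G t `|` Op t = Omega],
      ereal_sup [set geo_dist_set Omega x (G t) | x in Op t] = +oo%E &
      ereal_sup [set geo_dist_set Omega x (G t) | x in Om t] = +oo%E].

Definition front_depth (Omega : set V) (O G : R -> set V) : Prop :=
  ereal_inf
    [set ereal_sup [set geo_dist_set Omega y (G p.1) |
                     y in [set y | O p.1 y /\ (geo_dist Omega y p.2 <= r%:E)%E]]
    | p in [set p : R * V | G p.1 p.2]]
  @[r --> (+oo : set_system R)] --> +oo%E.

Definition front_graphs (G : R -> set V) : Prop :=
  exists2 k : nat, (1 <= k)%N & forall t : R,
  exists (omega : 'I_k -> set 'rV[R]_n) (psi : 'I_k -> 'rV[R]_n -> R)
         (Q : 'I_k -> 'M[R]_n.+1),
  [/\ forall i, open (omega i) /\ {within omega i, continuous (psi i)},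
      forall i, rotation (Q i) &
      G t `<=` \bigcup_(i in [set: 'I_k])
                 ((fun y => y *m Q i) @` graph_of (omega i) (psi i))].

Definition front_limits (Omega : set V) (Om Op G : R -> set V)
    (u : R -> V -> R) : Prop :=
  forall eps : R, 0 < eps -> exists2 M : R, 0 < M & forall (t : R) (x : V),
    (M%:E <= geo_dist_set Omega x (G t))%E ->
    (closure (Op t) x -> 1 - eps <= u t x) /\
    (closure (Om t) x -> u t x <= eps).

Definition front_families (Omega : set V) (u : R -> V -> R)
    (Om Op G : R -> set V) : Prop :=
  [/\ front_partition Omega Om Op G,
      front_depth Omega Om G /\ front_depth Omega Op G,
      front_graphs G &
      front_limits Omega Om Op G u].

Definition transition_front (f : R -> R) (h : R -> R) (u : R -> V -> R) :
    Prop :=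
  [/\ classical_solution f h u,
      forall (t : R) (x : V), closure (funnel h) x -> 0 < u t x < 1 &
      exists Om Op G, front_families (funnel h) u Om Op G].

Definition families_speed (Omega : set V) (G : R -> set V) (gamma : R) : Prop :=
  forall eps : R, 0 < eps -> exists T : R, forall t s,
    0 < `|t - s| -> T <= `|t - s| ->
    (`|geo_dist_sets Omega (G t) (G s) * (`|t - s|^-1)%:E - gamma%:E|
       <= eps%:E)%E.

(* Quantifying existentially over the families makes the negation of this     *)
(* property say that no choice of families yields a global mean speed.        *)
Definition global_mean_speed (h : R -> R) (u : R -> V -> R) (gamma : R) : Prop :=
  exists Om Op G, front_families (funnel h) u Om Op G /\
                  families_speed (funnel h) G gamma.

End TransitionFront.

(* Main.v *)
(* Comparison in the unbounded funnel works because it is star-shaped about a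
   point p of its axis: the barrier |x - p|^2 has a positive normal derivative.

   As t -> -oo, u is close to the planar front, which is decreasing with c > 0.
   Hence where u(t, x) > u(t + s, x) both values lie near 0 or near 1, where f is
   nonincreasing; the maximum principle, started from time -oo, then gives
   u(t, x) <= u(t + s, x).  Monotonicity in time turns blocking into the bound
   u <= u_infty, so that u is close to 0 far to the right of
   x_1 = c min(t, 0), and close to 1 far to its left.  Strict inequalities
   0 < u < 1 come from a subsolution supported in a flat growing ellipsoid.

   For any admissible families, the depth condition forces Gamma_t to remain at
   bounded distance from x_1 = c min(t, 0).  A global mean speed would then be
   equal to c (negative times) and to 0 (positive times), but c > 0. *)

Require Import Defs.
From HB Require Import structures.
From mathcomp Require Import fingroup perm.
From mathcomp Require Import all_boot all_order all_algebra.
From mathcomp Require Import all_classical all_reals all_analysis.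
From mathcomp Require Import ring lra.
Set Implicit Arguments.
Unset Strict Implicit.
Unset Printing Implicit Defensive.
Import Order.TTheory GRing.Theory Num.Theory.
Import numFieldNormedType.Exports.
Local Open Scope classical_set_scope.
Local Open Scope ring_scope.

(** * One-variable calculus and the planar front *)

Section RealFunctions.
Variable R : realType.
Implicit Types (f g dg phi : R -> R).

(** Neither [0 < c] nor the monotonicity of [phi] is part of the definition of a planar front. Both
    come from the energy phi'^2 / 2 + F(phi), where F' = f, which is monotone along the profile. At
    the boundary only the continuous extension of the gradient is used: the barrier has a strictly
    signed normal derivative, which contradicts the sign forced by a boundary maximum. The obstacle
    to an explicit positive subsolution is the Neumann condition on the widening wall, where the x_1
    component of the gradient of a bump may have the wrong sign. Stretching the bump along x_1 makes
    that component small against the radial one, which on the wall is at least of the order of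
    [rad]. Geodesic distance is controlled by |x_1 - y_1| only where the cross-sections have bounded
    radius. This is harmless here: the interfaces stay in x_1 <= 0, where the funnel is a cylinder,
    and far to the right x_1 alone shows that u is small. *)

Lemma is_derive_near_quotient g (x d lo : R) : is_derive x 1 g d -> lo < d ->
  exists2 r : R, 0 < r &
    forall y, y != 0 -> `|y| < r -> lo < y^-1 * (g (x + y) - g x).
Proof.
move=> [dg dgE] lod.
have : (fun y => y^-1 *: ((g \o shift x) (y *: 1) - g x)) @ 0^' --> d.
  by rewrite -dgE; exact: dg.
move=> /cvgr_gt /(_ _ lod) [r /= r0 rP]; exists r => // y y0 yr.
have := rP y; rewrite /= sub0r normrN => /(_ yr y0).
by rewrite [_ *: 1]mulr1 [y + x]addrC.
Qed.

(** Here [dg] is differentiable at the single point x. If [d2] were positive, [dg] would be positive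
    just to the right of x, and the mean value theorem would give values above g(x). *)
Lemma local_max_derivatives g dg (x d2 e : R) : 0 < e ->
  (forall y, `|y - x| < e -> is_derive y 1 g (dg y)) ->
  is_derive x 1 dg d2 ->
  (forall y, `|y - x| < e -> g y <= g x) -> dg x = 0 /\ d2 <= 0.
Proof.
move=> e0 gdg dgd2 gx.
have itvE y : y \in `](x - e), (x + e)[ -> `|y - x| < e.
  by rewrite in_itv /= ltr_distl.
have dgx0 : dg x = 0.
  have [] := @derive1_at_max _ g (x - e) (x + e) x.
  - lra.
  - by move=> y /itvE /gdg[].
  - by rewrite in_itv /=; lra.
  - by move=> y /itvE; exact: gx.
  move=> _ <-; have [//|_ ->//] := gdg x.
  by rewrite subrr normr0.
split=> //; rewrite leNgt; apply/negP => d20.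
have [r r0 rP] := is_derive_near_quotient dgd2 d20.
pose y := Num.min r e / 2.
have re0 : 0 < Num.min r e by rewrite lt_min r0.
have [yr ye] : y < r /\ y < e.
  have : y < Num.min r e by rewrite /y; lra.
  by rewrite lt_min => /andP[].
have y0 : 0 < y by rewrite /y; lra.
have gder z : z \in `]x, (x + y)[ -> is_derive z 1 g (dg z).
  by rewrite in_itv /= => zxy; apply: gdg; rewrite ltr_distl; lra.
have gcont : {within `[x, (x + y)], continuous g}.
  apply: derivable_within_continuous => z; rewrite in_itv /= => zxy.
  by have [|//] := gdg z; rewrite ltr_distl; lra.
have [|z /[!in_itv] /= zxy zE] := MVT _ gder gcont; first by lra.
have := gx (x + y); rewrite addrAC subrr add0r gtr0_norm // => /(_ ye).
rewrite -subr_le0 zE addrAC subrr add0r pmulr_lle0 // => dgz.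
have := rP (z - x); rewrite [x + _]addrC subrK dgx0 subr0 gtr0_norm; last lra.
have zx : 0 < z - x by lra.
rewrite gt_eqF // => /(_ isT) rz.
have zr : z - x < r by lra.
by have := rz zr; rewrite pmulr_rgt0 ?invr_gt0 // ltNge dgz.
Qed.


(** * Consequences of bistability *)

Lemma bistable_antiderivative f theta : bistable f theta ->
  exists F : R -> R, [/\ F 0 < F 1, {within `[0 : R, 1 : R], continuous F} &
    forall x : R, 0 < x < 1 -> is_derive x 1 F (f x)].
Proof.
move=> [[df _] _ _ fint _].
have cf : {within `[0, 1], continuous f}.
  by apply: derivable_within_continuous => x; rewrite in_itv /=; exact: df.
have fi : lebesgue_measure.-integrable `[0, 1] (EFin \o f).
  by apply: continuous_compact_integrable => //; exact: segment_compact.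
exists (fun x => parameterized_integral lebesgue_measure 0 x f); split.
- by rewrite {1}/parameterized_integral set_itv1 Rintegral_set1.
- exact: parameterized_integral_continuous.
- move=> x /andP[x0 x1].
  have fx : {for x, continuous f}.
    apply: differentiable_continuous; apply/derivable1_diffP; apply: df.
    by rewrite !ltW.
  have [dF dFE] := continuous_FTC1_closed x1 fi x0 fx.
  by split; [exact: dF|rewrite -derive1E; exact: dFE].
Qed.

Lemma within01_near (F : R -> R) (p e : R) : {within `[0 : R, 1 : R], continuous F} ->
  0 <= p <= 1 -> 0 < e -> exists2 r : R, 0 < r &
    forall q, 0 <= q <= 1 -> `|q - p| < r -> `|F q - F p| < e.
Proof.
move=> /subspace_continuousP cF p01 e0.
have /cvgr_distC_lt /(_ _ e0) [r /= r0 rP] : F @ within `[0, 1] (nbhs p) --> F p.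
  by apply: cF; rewrite /= in_itv.
exists r => // q q01 qp; apply: rP; first by rewrite /= distrC.
by rewrite /= in_itv.
Qed.

Lemma bistable_mvt f theta (a b : R) : bistable f theta ->
  0 <= a -> a <= b -> b <= 1 ->
  exists2 z, a <= z <= b & f b - f a = derive1 f z * (b - a).
Proof.
move=> [[df _] _ _ _ _] a0 ab b1.
have [x||z /[!in_itv] /= zab ->] := @MVT_segment _ f (derive1 f) a b ab.
- by rewrite in_itv /= => xab; rewrite derive1E; apply/derivableP/df; lra.
- apply: derivable_within_continuous => x; rewrite in_itv /= => xab.
  by apply: df; lra.
by exists z.
Qed.

Lemma bistable_derive_lipschitz f theta : bistable f theta ->
  exists2 k : R, 0 <= k & forall a b : R, 0 <= a <= 1 -> 0 <= b <= 1 ->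
    `|derive1 f a - derive1 f b| <= k * `|a - b|.
Proof.
move=> [[_ [k kP]] _ _ _ _]; exists (Num.max 0 k); first by rewrite le_max lexx.
move=> a b a01 b01; apply: le_trans (kP (a, b) _) _; first by split; rewrite /= in_itv.
by rewrite ler_wpM2r // le_max lexx orbT.
Qed.

Lemma bistable_lipschitz f theta : bistable f theta ->
  exists2 K : R, 0 <= K & forall a b : R, 0 <= a <= 1 -> 0 <= b <= 1 ->
    `|f a - f b| <= K * `|a - b|.
Proof.
move=> hf; have [k k0 kP] := bistable_derive_lipschitz hf.
exists (`|derive1 f 0| + k); first by rewrite addr_ge0.
move=> a b; wlog ab : a b / a <= b.
  move=> W a01 b01; have [/W|/ltW/W] := leP a b; first exact.
  by rewrite distrC [`|b - a|]distrC; exact.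
move=> /andP[a0 a1] /andP[b0 b1].
have [z zab zE] := bistable_mvt hf a0 ab b1.
rewrite distrC zE normrM [`|b - a|]distrC ler_wpM2r //.
have := kP z 0; rewrite subr0 => /(_ ltac:(lra) ltac:(lra)) zk.
have z1 : k * `|z| <= k by rewrite ler_piMr // ger0_norm; lra.
have := ler_normD (derive1 f 0) (derive1 f z - derive1 f 0).
by rewrite addrC subrK; lra.
Qed.

Lemma bistable_nonincreasing_near_stable f theta : bistable f theta ->
  exists2 d : R, 0 < d & forall a b : R, 0 <= a -> a <= b -> b <= 1 ->
    b <= d \/ 1 - d <= a -> f b <= f a.
Proof.
move=> hf; have [k k0 kP] := bistable_derive_lipschitz hf.
have [_ [_ _ f0 f1] _ _ _] := hf.
pose m := Num.min (- derive1 f 0) (- derive1 f 1).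
have m0 : 0 < m by rewrite lt_min; lra.
(* Within this distance of 0 or 1 the derivative of f varies by at most m, hence stays nonpositive;
   k + 1 avoids a division by zero. *)
exists (m / (k + 1)); first by rewrite divr_gt0 //; lra.
move=> a b a0 ab b1 abd.
have [z zab zE] := bistable_mvt hf a0 ab b1.
rewrite -subr_le0 zE mulr_le0_ge0 ?subr_ge0 //.
have kd x : 0 <= x -> x <= m / (k + 1) -> k * x <= m.
  move=> x0; rewrite ler_pdivlMr; last by lra.
  by lra.
have [m1 m2] : m <= - derive1 f 0 /\ m <= - derive1 f 1.
  by rewrite !ge_min !lexx orbT.
case: abd => [bd|ad].
  have z0 : 0 <= z by lra.
  have kz := kd z z0 (ltac:(lra)).
  have := kP z 0; rewrite subr0 (ger0_norm z0) ler_norml.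
  by move=> /(_ ltac:(lra) ltac:(lra)); lra.
have z0 : 0 <= 1 - z by lra.
have kz := kd (1 - z) z0 (ltac:(lra)).
have := kP z 1; rewrite [`|z - 1|]distrC (ger0_norm z0) ler_norml.
by move=> /(_ ltac:(lra) ltac:(lra)); lra.
Qed.

(** * The planar front: sign of the speed and strict monotonicity *)

Section PlanarFront.
Variables (f phi : R -> R) (theta c : R).
Hypothesis hf : bistable f theta.
Hypothesis hphi : planar_front f theta c phi.

Let phi01 (z : R) : 0 < phi z < 1. Proof. by case: hphi. Qed.

Let dphi (z : R) : is_derive z 1 phi (derive1 phi z).
Proof.
case: hphi => /(_ z)[phid _] _ _ _ _.
by rewrite derive1E; exact: derivableP.
Qed.

Let ddphi (z : R) : is_derive z 1 (derive1 phi) (- c * derive1 phi z - f (phi z)).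
Proof.
case: hphi => /(_ z)[_ phidd] /(_ z) eq_phi _ _ _.
apply: DeriveDef => //; rewrite -derive1E.
by move: eq_phi; rewrite /derive1n /=; lra.
Qed.

Let phic : continuous phi.
Proof.
move=> z; apply: differentiable_continuous; apply/derivable1_diffP.
by have [] := dphi z.
Qed.

Lemma front_near_pinfty (e : R) : 0 < e -> exists A, forall z, A <= z -> phi z < e.
Proof.
move=> e0; case: hphi => _ _ [_ /cvgr_lt /(_ _ e0) [A [_ AP]]] _ _.
by exists (A + 1) => z Az; apply: AP; lra.
Qed.

Lemma front_near_ninfty (e : R) : 0 < e -> exists A, forall z, z <= A -> 1 - e < phi z.
Proof.
move=> e0; have e1 : 1 - e < 1 by lra.
case: hphi => _ _ [/cvgr_gt /(_ _ e1) [A [_ AP]] _] _ _.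
by exists (A - 1) => z Az; apply: AP; lra.
Qed.

Let phi_mvt (a b : R) : a < b ->
  exists2 z, a < z < b & phi b - phi a = derive1 phi z * (b - a).
Proof.
move=> ab; have [|z /[!in_itv] /= zab ->] := MVT ab (fun x _ => dphi x).
  exact: continuous_subspaceT.
by exists z.
Qed.

(** Convergence of phi' at infinity is avoided: on a far interval of length 1 the variation of phi
    is small, so the mean value theorem yields one point there where phi' is small, and one such
    point is enough. *)
Let energy_lim_pinfty F (A e : R) : {within `[0 : R, 1 : R], continuous F} -> 0 < e ->
  exists2 z, A <= z & `|derive1 phi z ^+ 2 / 2 + F (phi z) - F 0| < e.
Proof.
move=> cF e0; have e20 : 0 < e / 2 by lra.
have [|r r0 rP] := within01_near (p := 0) cF _ e20; first by rewrite lexx ler01.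
(* The bound r serves the continuity of F, the bound e the kinetic term, and the bound 1 gives
   phi'^2 <= |phi'|. *)
have m0 : 0 < Num.min (Num.min r e) 1 by rewrite !lt_min r0 e0 ltr01.
have [B BP] := front_near_pinfty m0.
pose a := Num.max A B.
have aA : A <= a by rewrite /a le_max lexx.
have aB : B <= a by rewrite /a le_max lexx orbT.
have [|z /andP[az zb] zE] := @phi_mvt a (a + 1); first by lra.
exists z; first by lra.
have Fz : `|F (phi z) - F 0| < e / 2.
  have /BP : B <= z by lra.
  rewrite !lt_min => /andP[/andP[zr _] _]; have /andP[z0 z1] := phi01 z.
  by apply: rP; rewrite ?subr0 ?gtr0_norm // ltW //= ltW.
have dz : `|derive1 phi z| < Num.min (Num.min r e) 1.
  have /andP[? _] := phi01 a; have /andP[? _] := phi01 (a + 1).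
  move: zE; rewrite addrAC subrr add0r mulr1 => <-.
  have ? := BP a aB; have ? : phi (a + 1) < Num.min (Num.min r e) 1 by apply: BP; lra.
  by rewrite ltr_norml; lra.
move: dz; rewrite !lt_min => /andP[/andP[_ dze] dz1].
have d2 : derive1 phi z ^+ 2 <= `|derive1 phi z|.
  by rewrite -real_normK ?num_real // expr2 ler_piMr // ltW.
have d20 : 0 <= derive1 phi z ^+ 2 by exact: sqr_ge0.
by move: Fz; rewrite !ltr_norml; lra.
Qed.

Let energy_lim_ninfty F (A e : R) : {within `[0 : R, 1 : R], continuous F} -> 0 < e ->
  exists2 z, z <= A & `|derive1 phi z ^+ 2 / 2 + F (phi z) - F 1| < e.
Proof.
move=> cF e0; have e20 : 0 < e / 2 by lra.
have [|r r0 rP] := within01_near (p := 1) cF _ e20; first by rewrite lexx ler01.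
have m0 : 0 < Num.min (Num.min r e) 1 by rewrite !lt_min r0 e0 ltr01.
have [B BP] := front_near_ninfty m0.
pose a := Num.min A B.
have aA : a <= A by rewrite /a ge_min lexx.
have aB : a <= B by rewrite /a ge_min lexx orbT.
have [|z /andP[az zb] zE] := @phi_mvt (a - 1) a; first by lra.
exists z; first by lra.
have Fz : `|F (phi z) - F 1| < e / 2.
  have /BP zm : z <= B by lra.
  have : 1 - phi z < Num.min (Num.min r e) 1 by lra.
  rewrite !lt_min => /andP[/andP[zr _] _]; have /andP[z0 z1] := phi01 z.
  by apply: rP; rewrite ?ltr_norml; lra.
have dz : `|derive1 phi z| < Num.min (Num.min r e) 1.
  have /andP[_ ?] := phi01 a; have /andP[_ ?] := phi01 (a - 1).
  move: zE; rewrite (_ : a - (a - 1) = 1) ?mulr1; last by lra.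
  move=> <-.
  have ? := BP a aB; have ? : 1 - Num.min (Num.min r e) 1 < phi (a - 1) by apply: BP; lra.
  by rewrite ltr_norml; lra.
move: dz; rewrite !lt_min => /andP[/andP[_ dze] dz1].
have d2 : derive1 phi z ^+ 2 <= `|derive1 phi z|.
  by rewrite -real_normK ?num_real // expr2 ler_piMr // ltW.
have d20 : 0 <= derive1 phi z ^+ 2 by exact: sqr_ge0.
by move: Fz; rewrite !ltr_norml; lra.
Qed.

(* Multiplying the profile equation by phi' shows that the energy
   phi'^2 / 2 + F(phi) has derivative - c phi'^2. *)
Let energy_mvt F (a b : R) : (forall x : R, 0 < x < 1 -> is_derive x 1 F (f x)) -> a < b ->
  exists z, (derive1 phi b ^+ 2 / 2 + F (phi b)) - (derive1 phi a ^+ 2 / 2 + F (phi a)) =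
    - c * derive1 phi z ^+ 2 * (b - a).
Proof.
move=> dF ab.
pose E z := 2^-1 * (derive1 phi z * derive1 phi z) + F (phi z).
have dE (z : R) : is_derive z 1 E (- c * derive1 phi z ^+ 2).
  have dFz := dF _ (phi01 z).
  have dz := dphi z; have ddz := ddphi z.
  apply: (@is_derive_eq _ _ _ _ _ _ _
    (2^-1 *: (derive1 phi z *: (- c * derive1 phi z - f (phi z)) +
              derive1 phi z *: (- c * derive1 phi z - f (phi z))) + f (phi z) * derive1 phi z)).
  rewrite /GRing.scale /=; lra.
have [|z _ zE] := MVT ab (fun x _ => dE x).
  apply: continuous_subspaceT => x.
  apply: differentiable_continuous; apply/derivable1_diffP.
  by have [] := dE x.
by exists z; rewrite -zE /E; lra.
Qed.

(** The energy is close to F(1) at suitable points near -oo and to F(0) near +oo. For c <= 0 it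
    would be nondecreasing, against F(0) < F(1), which is the sign of the integral of f. *)
Lemma front_speed_gt0 : 0 < c.
Proof.
rewrite ltNge; apply/negP => c0.
have [F [F01 cF dF]] := bistable_antiderivative hf.
have e0 : 0 < (F 1 - F 0) / 2 by lra.
have [a a0] := energy_lim_ninfty (-1) cF e0.
have [b b0] := energy_lim_pinfty 1 cF e0.
have [|z zE] := @energy_mvt F a b dF; first by lra.
have : 0 <= - c * derive1 phi z ^+ 2 * (b - a).
  by apply: mulr_ge0; [apply: mulr_ge0; rewrite ?oppr_ge0 ?sqr_ge0 | lra].
by rewrite -zE !ltr_norml; lra.
Qed.

(** Since c > 0 the energy is nonincreasing, and it comes arbitrarily close to F(0) on the right of
    z. *)
Let energy_ge F (z : R) : {within `[0 : R, 1 : R], continuous F} ->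
  (forall x : R, 0 < x < 1 -> is_derive x 1 F (f x)) ->
  F 0 <= derive1 phi z ^+ 2 / 2 + F (phi z).
Proof.
move=> cF dF; rewrite leNgt; apply/negP => Fz.
have e0 : 0 < F 0 - (derive1 phi z ^+ 2 / 2 + F (phi z)) by lra.
have [b b0] := energy_lim_pinfty (z + 1) cF e0.
have [|y yE] := @energy_mvt F z b dF; first by lra.
have : 0 <= c * derive1 phi y ^+ 2 * (b - z).
  have ? := ltW front_speed_gt0.
  by apply: mulr_ge0; [apply: mulr_ge0; rewrite ?sqr_ge0 | lra].
by move: yE; rewrite !mulNr ltr_norml; lra.
Qed.

(* At a critical point the energy bound gives F(phi) >= F(0), hence
   phi > theta and phi'' = - f(phi) < 0: there is no interior minimum. *)
Lemma front_decreasing (a b : R) : a < b -> phi b < phi a.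
Proof.
move=> ab; rewrite ltNge; apply/negP => phiab.
have [F [F01 cF dF]] := bistable_antiderivative hf.
have [e0 e0P] : exists z, z < a /\ phi a < phi z.
  have /andP[_ a1] := phi01 a.
  have e0 : 0 < 1 - phi a by lra.
  have [A AP] := front_near_ninfty e0.
  exists (Num.min A (a - 1)); split; first by rewrite gt_min; apply/orP; right; lra.
  have := AP (Num.min A (a - 1)); rewrite ge_min lexx => /(_ isT).
  by rewrite opprB addrC subrK.
(* The value at a is below the one at [e0] and not above the one at b, so the minimum is attained
   inside; if the extreme value theorem returns b, then a is a minimum as well. *)
have [m mab mP] : exists2 m, e0 < m < b & forall z, e0 < z < b -> phi m <= phi z.
  have e0b : e0 <= b by lra.
  have [|m /[!in_itv] /= mab mP] := @EVT_min _ phi e0 b e0b.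
    exact: continuous_subspaceT.
  have ma : phi m <= phi a by apply: mP; rewrite in_itv /=; lra.
  have [mb|mb] := eqVneq m b.
    exists a; first by lra.
    move=> z zab; apply: le_trans phiab _; rewrite -mb; apply: mP.
    by rewrite in_itv /=; lra.
  exists m; last by move=> z zab; apply: mP; rewrite in_itv /=; lra.
  rewrite !lt_neqAle mb; have /andP[-> ->] := mab; rewrite !andbT.
  by apply/eqP => e0m; move: ma; rewrite -e0m; lra.
pose r := Num.min (m - e0) (b - m).
have r0 : 0 < r by rewrite lt_min; lra.
have [] := @local_max_derivatives (- phi) (- derive1 phi) m
  (- (- c * derive1 phi m - f (phi m))) r r0.
- by move=> y _; have dy := dphi y; exact: is_deriveN.
- by have ddm := ddphi m; exact: is_deriveN.
- move=> y; rewrite lt_min !ltr_norml => ymr; rewrite lerN2; apply: mP.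
  by lra.
rewrite !fctE => /eqP; rewrite oppr_eq0 => /eqP dm0.
rewrite dm0 mulr0 sub0r opprK leNgt => /negP; apply.
case: hf => _ _ [theta01 _ fpos _] _ _; apply: fpos.
have /andP[m0 m1] := phi01 m; rewrite m1 andbT ltNge; apply/negP => mtheta.
have := energy_ge m cF dF; rewrite dm0 expr0n mul0r add0r leNgt => /negP; apply.
(* F' = f is negative on (0, theta), so F(phi m) < F(0) if phi m <= theta. *)
have sub : {within `[0, phi m], continuous F}.
  apply: continuous_subspaceW cF; apply: subset_itvl.
  by rewrite bnd_simp ltW.
have dFm (x : R) : x \in `]0, (phi m)[ -> is_derive x 1 F (f x).
  by rewrite in_itv /= => xm; apply: dF; lra.
have [z /[!in_itv] /= zm zE] := MVT m0 dFm sub.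
rewrite -subr_lt0 zE subr0 pmulr_llt0 //.
by case: hf => _ _ [_ fneg _ _] _ _; apply: fneg; lra.
Qed.

End PlanarFront.

End RealFunctions.

(** * Geometry of the funnel *)

Section Euclidean.
Variable R : realType.

Lemma edot_ge0 (k : nat) (x : 'rV[R]_k) : 0 <= edot x x.
Proof. by apply: sumr_ge0 => i _; rewrite -expr2 sqr_ge0. Qed.

Lemma enorm_ge0 (k : nat) (x : 'rV[R]_k) : 0 <= enorm x.
Proof. exact: sqrtr_ge0. Qed.

Lemma enorm_sqr (k : nat) (x : 'rV[R]_k) : enorm x ^+ 2 = edot x x.
Proof. by rewrite sqr_sqrtr ?edot_ge0. Qed.

Lemma enormZ (k : nat) (a : R) (x : 'rV[R]_k) : enorm (a *: x) = `|a| * enorm x.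
Proof.
rewrite /enorm -sqrtr_sqr -sqrtrM ?sqr_ge0 //; congr (Num.sqrt _).
by rewrite /edot mulr_sumr; apply: eq_bigr => i _; rewrite !mxE; ring.
Qed.

Lemma coord_le_enorm (k : nat) (x : 'rV[R]_k) (i : 'I_k) : `|x 0 i| <= enorm x.
Proof.
rewrite -sqrtr_sqr ler_sqrt ?edot_ge0 // /edot (bigD1 i) //= -expr2 lerDl.
by apply: sumr_ge0 => j _; rewrite -expr2 sqr_ge0.
Qed.

Lemma enorm_le_sum (k : nat) (x : 'rV[R]_k) : enorm x <= \sum_i `|x 0 i|.
Proof.
have S0 : 0 <= \sum_i `|x 0 i| by apply: sumr_ge0.
rewrite -[leRHS]ger0_norm // -sqrtr_sqr ler_sqrt ?sqr_ge0 //.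
rewrite expr2 mulr_suml; apply: ler_sum => i _.
rewrite -expr2 -real_normK ?num_real // expr2 ler_wpM2l //.
by rewrite (bigD1 i) //= lerDl sumr_ge0.
Qed.

Lemma rV_norm_le (k : nat) (x : 'rV[R]_k) (C : R) :
  0 <= C -> (forall i, `|x 0 i| <= C) -> `|x| <= C.
Proof.
move=> C0 xC; rewrite /Num.Def.normr /= mx_normrE; apply/bigmax_leP; split=> // -[i j] _ /=.
by rewrite ord1.
Qed.

Lemma coord_le_norm (k : nat) (x : 'rV[R]_k) (i : 'I_k) : `|x 0 i| <= `|x|.
Proof.
rewrite [leRHS]/Num.Def.normr /= mx_normrE; apply/bigmax_geP; right => /=.
by exists (0, i).
Qed.

Lemma continuous_enorm (T : topologicalType) (k : nat) (g : T -> 'rV[R]_k) :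
  (forall i, continuous (fun t => g t 0 i)) -> continuous (fun t => enorm (g t)).
Proof.
move=> cg; have cdot : continuous (fun t => edot (g t) (g t)).
  apply: (@continuous_big R _ +%R 0 xpredT add_continuous) => i _ t.
  by apply: cvgM; exact: cg.
by move=> t; apply: (@continuous_comp _ _ _ (fun t => edot (g t) (g t)) Num.sqrt);
  [exact: cdot|exact: sqrt_continuous].
Qed.

End Euclidean.

Section FunnelGeometry.
Variables (R : realType) (n : nat).
Notation V := 'rV[R]_n.+1.
Implicit Types (x y : V).

Definition mkpoint (s : R) (z : 'rV[R]_n) : V :=
  \row_i oapp (fun j => z 0 j) s (unlift ord0 i).

Lemma fstc_mkpoint s z : fstc (mkpoint s z) = s.
Proof. by rewrite /fstc mxE unlift_none. Qed.

Lemma sndc_mkpoint s z : sndc (mkpoint s z) = z.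
Proof. by apply/rowP => i; rewrite !mxE liftK. Qed.

Lemma mkpointK x : mkpoint (fstc x) (sndc x) = x.
Proof.
apply/rowP => i; rewrite mxE.
by case: unliftP => [j|] -> //=; rewrite mxE.
Qed.

Lemma fstcB x y : fstc (x - y) = fstc x - fstc y.
Proof. by rewrite /fstc !mxE. Qed.

Lemma fstc_le_enorm x : `|fstc x| <= enorm x.
Proof. exact: coord_le_enorm. Qed.

Lemma continuous_fstc : continuous (@fstc R n).
Proof. exact: coord_continuous. Qed.

Lemma continuous_enorm_sndc : continuous (fun x : V => enorm (sndc x)).
Proof.
apply: (@continuous_enorm R V n (@sndc R n)) => i.
have -> : (fun t : V => sndc t 0 i) = (fun t : V => t 0 (lift ord0 i)).
  by apply/funext => t; rewrite mxE.
exact: coord_continuous.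
Qed.

Variable h : R -> R.
Hypothesis hc : continuous h.
Hypothesis h0 : forall s, 0 < h s.

Let gap x := enorm (sndc x) - h (fstc x).

Let continuous_gap : continuous gap.
Proof.
move=> x.
apply: (@continuousB _ _ _ (fun x : V => enorm (sndc x)) (fun x => h (fstc x))).
  exact: continuous_enorm_sndc.
by apply: continuous_comp; [exact: continuous_fstc|exact: hc].
Qed.

Lemma open_funnel : open (funnel h : set V).
Proof.
have -> : funnel h = gap @^-1` [set r | r < 0].
  by apply/seteqP; split=> x; rewrite /funnel /gap /= subr_lt0.
by apply: open_comp => [x _|]; [exact: continuous_gap|exact: open_lt].
Qed.

(** A point with |x'| = h(x_1) is a limit of points of the funnel obtained by contracting x' towards
    the axis with x_1 fixed. *)
Lemma closure_funnel : closure (funnel h) = [set x : V | enorm (sndc x) <= h (fstc x)].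
Proof.
apply/seteqP; split.
  have cS : closed [set x : V | enorm (sndc x) <= h (fstc x)].
    have -> : [set x : V | enorm (sndc x) <= h (fstc x)] = gap @^-1` [set r | r <= 0].
      by apply/seteqP; split=> x; rewrite /gap /= subr_le0.
    by apply: preimage_closed => [x _|]; [exact: continuous_gap|exact: closed_le].
  rewrite [X in _ `<=` X]((closure_id _).1 cS).
  by apply: closure_subset => x /ltW.
move=> x /= xh B /nbhs_ballP[e /= e0 eB].
pose s := Num.min 1 (e / (enorm (sndc x) + 1)) / 2.
have D0 : 0 < enorm (sndc x) + 1 by rewrite ltr_wpDl ?enorm_ge0.
have m0 : 0 < Num.min 1 (e / (enorm (sndc x) + 1)) by rewrite lt_min ltr01 divr_gt0.
have m1 : Num.min 1 (e / (enorm (sndc x) + 1)) <= 1 by rewrite ge_min lexx.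
have me : Num.min 1 (e / (enorm (sndc x) + 1)) <= e / (enorm (sndc x) + 1).
  by rewrite ge_min lexx orbT.
have se : s * enorm (sndc x) < e.
  have : s * (enorm (sndc x) + 1) < e by rewrite -ltr_pdivlMr // /s; lra.
  by apply: le_lt_trans; rewrite ler_wpM2l ?lerDl ?ler01 // /s; lra.
exists (mkpoint (fstc x) ((1 - s) *: sndc x)); split.
  rewrite /funnel /= fstc_mkpoint sndc_mkpoint enormZ ger0_norm /s; last by lra.
  have [->|x0] := eqVneq (enorm (sndc x)) 0; first by rewrite mulr0.
  apply: lt_le_trans xh; rewrite gtr_pMl ?lt0r ?x0 ?enorm_ge0 //; lra.
apply: eB; rewrite -ball_normE /=.
apply: le_lt_trans se; apply: rV_norm_le.
  by rewrite mulr_ge0 ?enorm_ge0 // /s; lra.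
move=> i; rewrite !mxE; case: unliftP => [j|] -> /=; last first.
  by rewrite subrr normr0 mulr_ge0 ?enorm_ge0 // /s; lra.
rewrite !mxE mulrBl mul1r opprB addrC subrK normrM ger0_norm; last by rewrite /s; lra.
rewrite ler_wpM2l //; first by rewrite /s; lra.
by have := coord_le_enorm (sndc x) j; rewrite mxE.
Qed.

Lemma funnel_closure x : funnel h x -> closure (funnel h) x.
Proof. exact: subset_closure. Qed.

Lemma bdry_funnel x : bdry (funnel h) x <-> enorm (sndc x) = h (fstc x).
Proof.
have -> : bdry (funnel h) = closure (funnel h) `\` (funnel h : set V).
  by rewrite /bdry; have /interior_id -> := open_funnel.
rewrite closure_funnel /funnel; split=> /=.
  by move=> [xh /negP]; rewrite -leNgt => hx; apply/eqP; rewrite eq_le xh hx.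
by move=> ->; rewrite lexx ltxx.
Qed.

Lemma closure_funnelP x : closure (funnel h) x -> funnel h x \/ bdry (funnel h) x.
Proof.
rewrite bdry_funnel closure_funnel /funnel /= le_eqVlt => /orP[/eqP|]; by [right|left].
Qed.

Lemma funnel_axis s : funnel h (mkpoint s 0).
Proof.
rewrite /funnel /= fstc_mkpoint sndc_mkpoint.
suff -> : enorm (0 : 'rV[R]_n) = 0 by exact: h0.
by rewrite -(scale0r 0) enormZ normr0 mul0r.
Qed.

(** * Bounds on the geodesic distance *)

Section GeodesicDistance.

Lemma path_length_lipschitz (g : R -> V) (C : R) : 0 <= C ->
  (forall a b, a <= b -> enorm (g b - g a) <= C * (b - a)) ->
  (path_length g <= C%:E)%E.
Proof.
move=> C0 gC; apply: ge_ereal_sup => _ [s [ps /eqP ls] <-].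
rewrite lee_fin /polygon_length.
apply: (@le_trans _ _ (\sum_(i < size s) C * (nth 1 (0 :: s) i.+1 - nth 1 (0 :: s) i))).
  apply: ler_sum => i _; apply: gC.
  by have /(pathP 1)/(_ _ (ltn_ord i))/ltW := ps.
rewrite -mulr_sumr -(big_mkord xpredT (fun i => nth 1 (0 :: s) i.+1 - nth 1 (0 :: s) i)).
by rewrite telescope_sumr // nth_last /= ls subr0 mulr1.
Qed.

(** The subdivision with the single interval [0, 1] already bounds the length of any path below by
    its chord. *)
Lemma geo_dist_ge_fst (Omega : set V) x y :
  (`|fstc x - fstc y|%:E <= geo_dist Omega x y)%E.
Proof.
apply: le_ereal_inf_tmp => _ [g [_ g0 g1 _] <-].
apply: ereal_sup_ge; exists (polygon_length g [:: 1])%:E.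
  exists [:: 1] => //; exact: itv_partition1.
rewrite lee_fin /polygon_length big_ord1 /= g0 g1 distrC -fstcB.
exact: fstc_le_enorm.
Qed.

(** Projection onto [0, 1]: composed with affine maps, it gives coordinates that move on one third
    of the time interval and are frozen on the others, with a global Lipschitz bound. *)
Let clamp (s : R) := Num.max 0 (Num.min 1 s).

Let clamp01 s : 0 <= clamp s <= 1.
Proof. by rewrite /clamp le_max lexx ge_max ler01 ge_min lexx. Qed.

Let clamp_lip (a b : R) : a <= b -> 0 <= clamp b - clamp a <= b - a.
Proof.
by move=> ab; rewrite /clamp /Num.max /Num.min; repeat case: ifPn; rewrite -?leNgt; lra.
Qed.

Let clamp0 s : s <= 0 -> clamp s = 0.
Proof.
by move=> s0; rewrite /clamp /Num.max /Num.min; repeat case: ifPn; rewrite -?leNgt; lra.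
Qed.

Let clamp1 s : 1 <= s -> clamp s = 1.
Proof.
by move=> s0; rewrite /clamp /Num.max /Num.min; repeat case: ifPn; rewrite -?leNgt; lra.
Qed.

(* The path goes radially to the axis, along the axis, and radially outwards. *)
Lemma geo_dist_le x y : closure (funnel h) x -> closure (funnel h) y ->
  (geo_dist (funnel h) x y <=
   (3 * (`|fstc x - fstc y| + n%:R * (enorm (sndc x) + enorm (sndc y))))%:E)%E.
Proof.
rewrite closure_funnel /= => xh yh.
(* Each of p, m, q moves at speed 3 on its own third, whence the factor 3 of the bound; the factor n
   comes from bounding a Euclidean norm by the sum of the coordinates. *)
pose p (s : R) := 1 - clamp (3 * s).
pose m (s : R) := clamp (3 * s - 1).
pose q (s : R) := clamp (3 * s - 2).
pose g (s : R) : V := mkpoint (fstc x + m s * (fstc y - fstc x))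
  (p s *: sndc x + q s *: sndc y).
set C := 3 * _.
have C0 : 0 <= C.
  by rewrite mulr_ge0 // addr_ge0 // mulr_ge0 // addr_ge0 // enorm_ge0.
have gC a b : a <= b -> enorm (g b - g a) <= C * (b - a).
  move=> ab.
  have pL : `|p b - p a| <= 3 * (b - a).
    have : 3 * a <= 3 * b by lra.
    by move=> /clamp_lip; rewrite /p ler_norml; lra.
  have mL : `|m b - m a| <= 3 * (b - a).
    have : 3 * a - 1 <= 3 * b - 1 by lra.
    by move=> /clamp_lip; rewrite /m ler_norml; lra.
  have qL : `|q b - q a| <= 3 * (b - a).
    have : 3 * a - 2 <= 3 * b - 2 by lra.
    by move=> /clamp_lip; rewrite /q ler_norml; lra.
  apply: le_trans (enorm_le_sum _) _.
  rewrite big_ord_recl /C mulrAC mulrDr; apply: lerD.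
    rewrite [X in `|X|](_ : _ = (m b - m a) * (fstc y - fstc x)).
      by rewrite normrM [`|fstc y - _|]distrC ler_wpM2r.
    by rewrite !mxE unlift_none /=; ring.
  apply: (@le_trans _ _ (\sum_(i < n) (3 * (b - a) * (enorm (sndc x) + enorm (sndc y))))).
    apply: ler_sum => i _.
    rewrite [X in `|X|](_ : _ = (p b - p a) * sndc x 0 i + (q b - q a) * sndc y 0 i).
      apply: le_trans (ler_normD _ _) _; rewrite mulrDr !normrM.
      by apply: lerD; apply: ler_pM => //; exact: coord_le_enorm.
    by rewrite !mxE liftK /= !mxE; ring.
  by rewrite sumr_const card_ord -[leLHS]mulr_natl mulrCA.
apply: (@le_trans _ _ (path_length g)); last exact: path_length_lipschitz.
apply: ereal_inf_lbound; exists g => //; split.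
- apply: continuous_subspaceT => s; apply/cvgrPdist_lt => e e0.
  have C1 : 0 < C + 1 by lra.
  apply/nbhs_ballP; exists (e / (C + 1)); first by rewrite /= divr_gt0.
  move=> t; rewrite /= ltr_pdivlMr // => st.
  have gst a b : a <= b -> `|g b - g a| <= C * (b - a).
    move=> ab; apply: le_trans (gC _ _ ab); apply: rV_norm_le; first exact: enorm_ge0.
    exact: coord_le_enorm.
  have : `|g s - g t| <= C * `|s - t|.
    have [st'|/ltW ts] := leP s t.
      by rewrite distrC [`|s - t|]distrC (ger0_norm (x := t - s)) ?subr_ge0 ?gst.
    by rewrite (ger0_norm (x := s - t)) ?subr_ge0 ?gst.
  move=> gst'; apply: le_lt_trans gst' _.
  apply: le_lt_trans st; rewrite mulrC ler_wpM2l //; lra.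
- have m0 : m 0 = 0 by apply: clamp0; lra.
  have p0 : p 0 = 1 by rewrite /p clamp0 ?subr0 //; lra.
  have q0 : q 0 = 0 by apply: clamp0; lra.
  by rewrite /g m0 p0 q0 mul0r addr0 scale1r scale0r addr0 mkpointK.
- have m1 : m 1 = 1 by apply: clamp1; lra.
  have p1 : p 1 = 0 by rewrite /p clamp1 ?subrr //; lra.
  have q1 : q 1 = 1 by apply: clamp1; lra.
  by rewrite /g m1 p1 q1 mul1r addrC subrK scale0r scale1r add0r mkpointK.
move=> s s01; rewrite closure_funnel /= /g fstc_mkpoint sndc_mkpoint.
have p01 := clamp01 (3 * s); have q01 := clamp01 (3 * s - 2).
have [s1|s1] := leP s (1 / 3).
  have m0 : m s = 0 by apply: clamp0; lra.
  have q0 : q s = 0 by apply: clamp0; lra.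
  rewrite m0 q0 mul0r addr0 scale0r addr0 enormZ ger0_norm /p; last by lra.
  by apply: le_trans xh; rewrite ler_piMl ?enorm_ge0 //; lra.
have p0 : p s = 0 by rewrite /p clamp1 ?subrr //; lra.
rewrite p0 scale0r add0r enormZ; have [s2|s2] := leP s (2 / 3).
  have q0 : q s = 0 by apply: clamp0; lra.
  by rewrite q0 normr0 mul0r ltW.
have m1 : m s = 1 by apply: clamp1; lra.
rewrite m1 mul1r [fstc x + _]addrC subrK ger0_norm; last by rewrite /q; lra.
by apply: le_trans yh; rewrite ler_piMl ?enorm_ge0 // /q; lra.
Qed.

End GeodesicDistance.

End FunnelGeometry.

(** * The comparison principle *)

Section Lines.
Variable R : realType.

Lemma within_continuous_comp (S T U : topologicalType) (A : set S) (Q : set T)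
    (gam : S -> T) (F : T -> U) : continuous gam ->
  (forall s, A s -> Q (gam s)) -> {within Q, continuous F} ->
  {within A, continuous (F \o gam)}.
Proof.
move=> cgam AQ /subspace_continuousP cF; apply/subspace_continuousP => s As.
apply: (@cvg_trans _ (F @ within Q (nbhs (gam s)))); last exact/cF/AQ.
move=> P FP.
have Ps : \forall s' \near s, Q (gam s') -> P (F (gam s')) := cgam s _ FP.
have : \forall s' \near s, A s' -> P (F (gam s')).
  by apply: filterS Ps => s' Ps' As'; exact/Ps'/AQ.
exact.
Qed.

Lemma within_continuousD (T : topologicalType) (A : set T) (f g : T -> R) :
  {within A, continuous f} -> {within A, continuous g} ->
  {within A, continuous (fun x => f x + g x)}.
Proof. by move=> cf cg x; exact: (continuousD (cf x) (cg x)). Qed.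

Lemma within_continuousM (T : topologicalType) (A : set T) (f g : T -> R) :
  {within A, continuous f} -> {within A, continuous g} ->
  {within A, continuous (fun x => f x * g x)}.
Proof. by move=> cf cg x; exact: (continuousM (cf x) (cg x)). Qed.

Lemma within_continuousZ (T : topologicalType) (A : set T) (c : R) (f : T -> R) :
  {within A, continuous f} -> {within A, continuous (fun x => c * f x)}.
Proof.
by apply: within_continuousM; apply: continuous_subspaceT => x; exact: cvg_cst.
Qed.

Lemma is_derive_line (W : normedModType R) (F : W -> R) (x v : W) (s d : R) :
  is_derive (x + s *: v) v F d -> is_derive s 1 (fun r : R => F (x + r *: v)) d.
Proof.
move=> [dF dFE].
have E : (fun r : R => r^-1 *:
    (((fun r : R => F (x + r *: v)) \o shift s) (r *: 1) - F (x + s *: v))) =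
    (fun r => r^-1 *: ((F \o shift (x + s *: v)) (r *: v) - F (x + s *: v))).
  apply/funext => r /=; congr (_ *: (F _ - _)).
  by rewrite [r *: 1]mulr1 scalerDl addrCA.
by apply: DeriveDef; [rewrite /derivable E | rewrite /derive E].
Qed.

Lemma is_derive_cube (W : normedModType R) (F : W -> R) (x v : W) (d : R) :
  is_derive x v F d ->
  is_derive x v (fun y => F y * F y * F y) (3 * F x ^+ 2 * d).
Proof.
move=> dF.
have dF2 := is_deriveM dF dF; have dF3 := is_deriveM dF2 dF.
apply: (is_derive_eq dF3); rewrite /GRing.scale /= !fctE; ring.
Qed.

Lemma is_derive_coord (k : nat) (x : 'rV[R]_k.+1) (i j : 'I_k.+1) :
  is_derive x (basis_vec R i) (fun y : 'rV[R]_k.+1 => y 0 j) (i == j)%:R.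
Proof.
have E : (fun r : R => r^-1 *:
    (((fun y : 'rV[R]_k.+1 => y 0 j) \o shift x) (r *: basis_vec R i) - x 0 j))
    = fun r : R => r^-1 * r * (i == j)%:R.
  apply/funext => r /=; rewrite !mxE eqxx /= addrK eq_sym.
  by rewrite /GRing.scale /= mulrA.
have L : (fun r : R => r^-1 * r * (i == j)%:R) @ 0^' --> ((i == j)%:R : R).
  apply: cvg_near_cst; rewrite near_withinE; near=> r => r0.
  by rewrite mulVf // mul1r.
apply: DeriveDef; first by rewrite /derivable E; apply/cvg_ex; exists (i == j)%:R.
by rewrite /derive E; exact: cvg_lim.
Unshelve. all: by end_near.
Qed.

(** One-sided because a maximum over a time interval may be attained at its final time. *)
Lemma is_derive_left_max (g : R -> R) (t d e : R) : 0 < e ->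
  is_derive t 1 g d -> (forall s, t - e < s <= t -> g s <= g t) -> 0 <= d.
Proof.
move=> e0 gd gmax; rewrite leNgt; apply/negP => d0.
have gNd : is_derive t 1 (- g) (- d) by exact: is_deriveN.
have [|r r0 rP] := is_derive_near_quotient gNd (lo := 0); first by lra.
pose y := Num.min r e / 2.
have re0 : 0 < Num.min r e by rewrite lt_min r0.
have [yr ye] : y < r /\ y < e.
  have : y < Num.min r e by rewrite /y; lra.
  by rewrite lt_min => /andP[].
have y0 : 0 < y by rewrite /y; lra.
have := rP (- y); rewrite oppr_eq0 gt_eqF // normrN gtr0_norm // => /(_ isT yr).
have := gmax (t - y); rewrite !fctE => gy.
have {}gy : g (t - y) <= g t by apply: gy; lra.
rewrite invrN mulNr oppr_gt0 pmulr_rlt0 ?invr_gt0 //; lra.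
Qed.

End Lines.

(** * The profile of the funnel *)

Section Profile.
Variables (R : realType) (rad alpha : R) (h : R -> R).
Hypothesis hh : funnel_profile rad alpha h.
Hypothesis halpha : 0 < alpha < pi / 2.

Lemma profile_gt0 s : 0 < h s. Proof. by case: hh. Qed.

Lemma profile_derive_ge0 s : 0 <= derive1 h s.
Proof. by case: hh => _ _ /(_ s) /andP[]. Qed.

Lemma profile_derive_le s : derive1 h s <= tan alpha.
Proof. by case: hh => _ _ /(_ s) /andP[]. Qed.

Lemma profile_is_derive (s : R) : is_derive s 1 h (derive1 h s).
Proof. by case: hh => -[/(_ s) ? _ _] _ _ _ _; rewrite derive1E; exact: derivableP. Qed.

Lemma profile_continuous : continuous h.
Proof.
move=> s; apply: differentiable_continuous; apply/derivable1_diffP.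
by have [] := profile_is_derive s.
Qed.

Lemma profile_nondecreasing a b : a <= b -> h a <= h b.
Proof.
move=> ab; have [||z _ zE] := @MVT_segment _ h (derive1 h) a b ab.
- by move=> x _; exact: profile_is_derive.
- by apply: continuous_subspaceT; exact: profile_continuous.
by rewrite -subr_ge0 zE mulr_ge0 ?profile_derive_ge0 ?subr_ge0.
Qed.

(** A positive slope at a gives a strictly larger value just after a, and monotonicity preserves it.
    Hence moving along e_1 from a boundary point with h' > 0 enters the open funnel. *)
Lemma profile_increasing_after a b : 0 < derive1 h a -> a < b -> h a < h b.
Proof.
move=> ha0 ab; rewrite lt_neqAle profile_nondecreasing ?(ltW ab) // andbT.
apply/eqP => hab.
have [r r0 rP] := is_derive_near_quotient (profile_is_derive a) ha0.
pose y := Num.min r (b - a) / 2.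
have re0 : 0 < Num.min r (b - a) by rewrite lt_min r0 subr_gt0.
have [yr ye] : y < r /\ y < b - a.
  have : y < Num.min r (b - a) by rewrite /y; lra.
  by rewrite lt_min => /andP[].
have y0 : 0 < y by rewrite /y; lra.
have := rP y; rewrite gt_eqF // gtr0_norm // => /(_ isT yr).
rewrite pmulr_rgt0 ?invr_gt0 // subr_gt0 hab ltNge profile_nondecreasing //; lra.
Qed.

Lemma profile_ge_rad s : rad <= h s.
Proof.
case: hh => _ _ _ hrad _; have [s0|s0] := leP s 0; first by rewrite hrad.
by rewrite -(hrad 0) // profile_nondecreasing // ltW.
Qed.

(* The funnel is star-shaped with respect to the point of the axis where the
   cone begins. *)
Lemma profile_star_shaped : 0 < rad ->
  exists p : R, forall s, 0 < h s - derive1 h s * (s - p).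
Proof.
move=> rad0; case: hh => _ _ _ _ [L radL hcone].
have ca0 : 0 < cos alpha.
  have /andP[a0 a1] := halpha; apply: cos_gt0_pihalf.
  by rewrite a1 (lt_trans _ a0) // oppr_lt0 divr_gt0 ?pi_gt0.
have ta0 : 0 < tan alpha.
  have /andP[a0 a1] := halpha; rewrite /tan divr_gt0 // sin_gt0_pi // a0 /=.
  by apply: (lt_trans a1); have := pi_gt0 R; lra.
exists (L * cos alpha) => s.
have L0 : 0 < L * cos alpha by rewrite mulr_gt0 //; lra.
have [sL|Ls] := leP s (L * cos alpha).
  have : derive1 h s * (s - L * cos alpha) <= 0.
    by rewrite mulr_ge0_le0 ?profile_derive_ge0 ?subr_le0.
  have := profile_gt0 s; lra.
(* On the cone the quantity equals p tan(alpha), with p = L cos(alpha) > 0. *)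
have -> : derive1 h s = tan alpha.
  rewrite derive1E; apply: derive_val.
  apply: (@near_eq_is_derive R R R (fun r : R => r * tan alpha) h s 1 (tan alpha)).
    near=> r; rewrite hcone //; apply/ltW; near: r; exact: lt_nbhsr.
  apply: (is_derive_eq (is_deriveM (is_derive_id s 1) (is_derive_cst (tan alpha) s 1))).
  by rewrite scaler0 add0r /GRing.scale /= mulr1.
by rewrite hcone ?ltW // [s * _]mulrC -mulrBr mulr_gt0 //; lra.
Unshelve. all: by end_near.
Qed.

End Profile.

(** * Functions regular up to the boundary, and operations on them *)

Section Regularity.
Variables (R : realType) (n : nat) (Omega : set 'rV[R]_n.+1).
Notation V := 'rV[R]_n.+1.
Notation Q := [set p : R * V | closure Omega p.2].

(* [dw] is the gradient of [w] and [d2w] the diagonal of its Hessian. *)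
Definition regular (w wt : R -> V -> R) (dw d2w : R -> V -> V) : Prop :=
  [/\ {within Q, continuous (fun p : R * V => w p.1 p.2)},
      forall i, {within Q, continuous (fun p : R * V => dw p.1 p.2 0 i)},
      forall (t : R) x, Omega x -> is_derive t 1 (fun s : R => w s x) (wt t x),
      forall t x i, Omega x -> is_derive x (basis_vec R i) (w t) (dw t x 0 i) &
      forall t x i, Omega x ->
        is_derive x (basis_vec R i) (fun y => dw t y 0 i) (d2w t x 0 i)].

Lemma regular_addZ (c : R) (w wt z zt : R -> V -> R) (dw d2w dz d2z : R -> V -> V) :
  regular w wt dw d2w -> regular z zt dz d2z ->
  regular (fun t x => w t x + c * z t x) (fun t x => wt t x + c * zt t x)
    (fun t x => dw t x + c *: dz t x) (fun t x => d2w t x + c *: d2z t x).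
Proof.
move=> [cw cdw wtP dwP d2wP] [cz cdz ztP dzP d2zP]; split.
- by apply: within_continuousD => //; exact: within_continuousZ.
- move=> i; have -> : (fun p : R * V => (dw p.1 p.2 + c *: dz p.1 p.2) 0 i) =
      (fun p => dw p.1 p.2 0 i + c * dz p.1 p.2 0 i).
    by apply/funext => p; rewrite !mxE.
  by apply: within_continuousD => //; exact: within_continuousZ.
- move=> t x Ox; have d1 := wtP t x Ox; have d2 := ztP t x Ox.
  exact: (is_deriveD d1 (is_deriveZ c d2)).
- move=> t x i Ox; have d1 := dwP t x i Ox; have d2 := dzP t x i Ox.
  by rewrite !mxE; exact: (is_deriveD d1 (is_deriveZ c d2)).
- move=> t x i Ox; have d1 := d2wP t x i Ox; have d2 := d2zP t x i Ox.
  have -> : (fun y => (dw t y + c *: dz t y) 0 i) =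
      (fun y => dw t y 0 i + c * dz t y 0 i).
    by apply/funext => y; rewrite !mxE.
  by rewrite !mxE; exact: (is_deriveD d1 (is_deriveZ c d2)).
Qed.

Lemma regular_shift (s : R) (w wt : R -> V -> R) (dw d2w : R -> V -> V) :
  regular w wt dw d2w ->
  regular (fun t => w (t + s)) (fun t => wt (t + s)) (fun t => dw (t + s))
    (fun t => d2w (t + s)).
Proof.
move=> [cw cdw wtP dwP d2wP].
have cs : continuous (fun p : R * V => (p.1 + s, p.2)).
  have -> : (fun p : R * V => (p.1 + s, p.2)) = (fun p => p + (s, 0)).
    by apply/funext => -[a b]; congr pair; rewrite /= addr0.
  by move=> p; apply: cvgD; [exact: cvg_id|exact: cvg_cst].
split; last by move=> t x i; exact: d2wP.
- exact: (within_continuous_comp (gam := fun p : R * V => (p.1 + s, p.2)) cs _ cw).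
- move=> i.
  exact: (within_continuous_comp (gam := fun p : R * V => (p.1 + s, p.2)) cs _ (cdw i)).
- move=> t x Ox; have d1 := wtP (t + s) x Ox.
  have := @is_derive1_comp _ (fun r => w r x) (shift s) t (wt (t + s) x) 1 d1
    (is_derive_shift t 1 s).
  by rewrite mulr1.
- by move=> t x i; exact: dwP.
Qed.

(** A negative rate a absorbs zero-order terms: the Lipschitz constant of f, or the decay allowed to
    a subsolution. *)
Lemma regular_expM (a t0 : R) (w wt : R -> V -> R) (dw d2w : R -> V -> V) :
  regular w wt dw d2w ->
  regular (fun t x => expR (a * (t - t0)) * w t x)
    (fun t x => expR (a * (t - t0)) * (a * w t x + wt t x))
    (fun t x => expR (a * (t - t0)) *: dw t x)
    (fun t x => expR (a * (t - t0)) *: d2w t x).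
Proof.
move=> [cw cdw wtP dwP d2wP].
have cE : continuous (fun p : R * V => expR (a * (p.1 - t0))).
  move=> p; apply: (@continuous_comp _ _ _ (fun p : R * V => a * (p.1 - t0)) expR);
    last exact: continuous_expR.
  apply: continuousM; first exact: cvg_cst.
  by apply: continuousB; [exact: cvg_fst|exact: cvg_cst].
have dE (t : R) : is_derive t 1 (fun t => expR (a * (t - t0))) (expR (a * (t - t0)) * a).
  have d1 : is_derive t 1 (fun t => a * (t - t0)) a.
    have := is_deriveZ a (is_deriveB (is_derive_id t 1) (is_derive_cst t0 t 1)).
    by rewrite subr0 /GRing.scale /= mulr1.
  exact: (@is_derive1_comp _ expR (fun t => a * (t - t0)) t _ _ (is_derive_expR _) d1).
split.
- by apply: within_continuousM => //; exact: continuous_subspaceT.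
- move=> i; have -> : (fun p : R * V => (expR (a * (p.1 - t0)) *: dw p.1 p.2) 0 i) =
      (fun p => expR (a * (p.1 - t0)) * dw p.1 p.2 0 i).
    by apply/funext => p; rewrite !mxE.
  by apply: within_continuousM => //; exact: continuous_subspaceT.
- move=> t x Ox; have d1 := wtP t x Ox.
  apply: (is_derive_eq (is_deriveM (dE t) d1)).
  by rewrite /GRing.scale /=; ring.
- move=> t x i Ox; have d1 := dwP t x i Ox.
  by rewrite !mxE; exact: (is_deriveZ _ d1).
- move=> t x i Ox; have d1 := d2wP t x i Ox.
  have -> : (fun y => (expR (a * (t - t0)) *: dw t y) 0 i) =
      (fun y => expR (a * (t - t0)) * dw t y 0 i).
    by apply/funext => y; rewrite !mxE.
  by rewrite !mxE; exact: (is_deriveZ _ d1).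
Qed.

(** An odd power keeps the sign: where the cube is positive so is w, and a bump can be handled
    without truncating it at 0. *)
Lemma regular_cube (w wt : R -> V -> R) (dw d2w : R -> V -> V) :
  regular w wt dw d2w ->
  regular (fun t x => w t x * w t x * w t x) (fun t x => 3 * w t x ^+ 2 * wt t x)
    (fun t x => (3 * w t x ^+ 2) *: dw t x)
    (fun t x => \row_i (6 * w t x * dw t x 0 i ^+ 2 + 3 * w t x ^+ 2 * d2w t x 0 i)).
Proof.
move=> [cw cdw wtP dwP d2wP]; split.
- by do 2![apply: within_continuousM => //].
- move=> i; have -> : (fun p : R * V => ((3 * w p.1 p.2 ^+ 2) *: dw p.1 p.2) 0 i) =
      (fun p => 3 * (w p.1 p.2 * w p.1 p.2) * dw p.1 p.2 0 i).
    by apply/funext => p; rewrite !mxE expr2.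
  apply: within_continuousM => //; apply: within_continuousZ.
  exact: within_continuousM.
- by move=> t x Ox; exact/is_derive_cube/wtP.
- by move=> t x i Ox; rewrite !mxE; exact/is_derive_cube/dwP.
- move=> t x i Ox; have d1 := d2wP t x i Ox; have d0 := dwP t x i Ox.
  have -> : (fun y => ((3 * w t y ^+ 2) *: dw t y) 0 i) =
      (fun y => 3 * (w t y * w t y * dw t y 0 i)).
    by apply/funext => y; rewrite !mxE; ring.
  apply: (is_derive_eq (is_deriveZ 3 (is_deriveM (is_deriveM d0 d0) d1))).
  by rewrite !mxE /GRing.scale /= !fctE; ring.
Qed.

(** One family for three uses: the barrier |x - p|^2 (all a_i = 1), the stretched bump (a_i = k^2
    along x_1 and 1 otherwise), and the constant 1 (all a_i = 0). *)
Lemma regular_quadratic (a : 'I_n.+1 -> R) (p : V) (b s : R) :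
  regular (fun t x => b + s * t - \sum_i a i * (x 0 i - p 0 i) ^+ 2)
    (fun _ _ => s) (fun _ x => \row_i (- 2 * a i * (x 0 i - p 0 i)))
    (fun _ _ => \row_i (- 2 * a i)).
Proof.
have dc (x : V) i j : is_derive x (basis_vec R i) (fun y : V => y 0 j - p 0 j) (i == j)%:R.
  have d1 := is_derive_coord x i j.
  by apply: (is_derive_eq (is_deriveB d1 (is_derive_cst (p 0 j) x _))); rewrite subr0.
have cc i : continuous (fun q : R * V => q.2 0 i - p 0 i).
  move=> q; apply: cvgB; last exact: cvg_cst.
  by apply: (@continuous_comp _ _ _ snd (fun x : V => x 0 i));
    [exact: cvg_snd|exact: coord_continuous].
split.
- apply: continuous_subspaceT => q; apply: cvgB.
    apply: cvgD; first exact: cvg_cst.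
    by apply: cvgM; [exact: cvg_cst|exact: cvg_fst].
  apply: (@continuous_big R _ +%R 0 xpredT add_continuous) => i _ r.
  apply: cvgM; first exact: cvg_cst.
  by apply: cvgM; exact: cc.
- move=> i; have -> : (fun q : R * V => (\row_i (- 2 * a i * (q.2 0 i - p 0 i))) 0 i) =
      (fun q => - 2 * a i * (q.2 0 i - p 0 i)).
    by apply/funext => q; rewrite !mxE.
  apply: continuous_subspaceT => q.
  by apply: cvgM; [exact: cvg_cst|exact: cc].
- move=> t x _.
  have := is_deriveB (is_deriveD (is_derive_cst b t 1) (is_deriveZ s (is_derive_id t 1)))
    (is_derive_cst (\sum_i a i * (x 0 i - p 0 i) ^+ 2) t 1).
  by rewrite add0r subr0 /GRing.scale /= mulr1.
- move=> t x i _; rewrite mxE.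
  have dj j : is_derive x (basis_vec R i) (fun y : V => a j * (y 0 j - p 0 j) ^+ 2)
      (a j * (2 * (x 0 j - p 0 j) * (i == j)%:R)).
    have d1 := dc x i j.
    apply: (is_derive_eq (is_deriveZ (a j) (is_deriveM d1 d1))).
    by rewrite /GRing.scale /=; ring.
  have := is_deriveB (is_derive_cst (b + s * t) x (basis_vec R i)) (is_derive_sum dj).
  rewrite fct_sumE sub0r => H; apply: (is_derive_eq H).
  rewrite (bigD1 i) //= eqxx big1 ?addr0; first by rewrite mulr1; ring.
  by move=> j ji; rewrite eq_sym (negbTE ji) !mulr0.
- move=> t x i _; rewrite mxE.
  have -> : (fun y : V => (\row_i (- 2 * a i * (y 0 i - p 0 i))) 0 i) =
      (fun y : V => - 2 * a i * (y 0 i - p 0 i)).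
    by apply/funext => y; rewrite !mxE.
  have d1 := dc x i i.
  by apply: (is_derive_eq (is_deriveZ (- 2 * a i) d1)); rewrite eqxx [LHS]mulr1.
Qed.

End Regularity.

Section Comparison.
Variables (R : realType) (n : nat) (rad alpha : R) (h : R -> R).
Hypothesis hrad : 0 < rad.
Hypothesis halpha : 0 < alpha < pi / 2.
Hypothesis hh : funnel_profile rad alpha h.
Notation V := 'rV[R]_n.+1.
Notation Q := [set p : R * V | closure (funnel h) p.2].

Let hc := profile_continuous hh.
Let h0 := profile_gt0 hh.

Lemma edot_outward_normal (x v : V) :
  edot (outward_normal h x) v = (Num.sqrt (1 + derive1 h (fstc x) ^+ 2))^-1 *
    (\sum_i sndc x 0 i / enorm (sndc x) * v 0 (lift ord0 i) - derive1 h (fstc x) * v 0 ord0).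
Proof.
rewrite /edot big_ord_recl addrC mulrBr mulr_sumr /outward_normal !mxE /=; congr (_ + _).
  by apply: eq_bigr => i _; rewrite !mxE /= !mulrA.
by rewrite mulrN mulrA mulNr.
Qed.

Lemma outward_normal_scale_gt0 (s : R) : 0 < (Num.sqrt (1 + derive1 h s ^+ 2))^-1.
Proof. by rewrite invr_gt0 sqrtr_gt0 ltr_wpDr ?sqr_ge0. Qed.

(** * Necessary conditions at a spatial maximum *)

Section MaximumPoints.
Variables (z zt : R -> V -> R) (dz d2z : R -> V -> V) (t : R) (x : V).
Hypothesis zreg : regular (funnel h) z zt dz d2z.
Hypothesis zmax : forall y, closure (funnel h) y -> z t y <= z t x.

Lemma interior_maximum (i : 'I_n.+1) : funnel h x -> d2z t x 0 i <= 0.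
Proof.
move=> Ox; have [_ _ _ dzP d2zP] := zreg.
have := @open_funnel R n h hc; rewrite openE => /(_ x Ox) /nbhs_ballP[e /= e0 eP].
have lineO (s : R) : `|s - 0| < e -> funnel h (x + s *: basis_vec R i).
  rewrite subr0 => se; apply: eP; rewrite -ball_normE /= opprD addNKr normrN.
  apply: le_lt_trans se; apply: rV_norm_le => // j.
  by rewrite !mxE eqxx /= normrM ler_piMr //; case: (j == i); rewrite ?normr1 ?normr0.
have [|||_ //] := @local_max_derivatives _ (fun s => z t (x + s *: basis_vec R i))
    (fun s => dz t (x + s *: basis_vec R i) 0 i) 0 (d2z t x 0 i) e e0.
- by move=> s se; apply: is_derive_line; exact/dzP/lineO.
- by apply: (@is_derive_line _ V (fun y => dz t y 0 i)); rewrite scale0r addr0; exact: d2zP.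
- move=> s se; rewrite scale0r addr0; apply: zmax.
  by apply: funnel_closure; exact: lineO.
Qed.

(** At a boundary point [dz] is only a continuous extension. If the product were positive at x, it
    would be positive on a short segment entering the funnel, where z is differentiable, and the
    mean value theorem would contradict the maximum. *)
Lemma boundary_maximum_coord (i : 'I_n.+1) (a : R) : closure (funnel h) x ->
  (forall s, 0 < s <= 1 -> funnel h (x + s *: (a *: basis_vec R i))) ->
  a * dz t x 0 i <= 0.
Proof.
move=> cx lineO; have [cz cdz _ dzP _] := zreg.
rewrite leNgt; apply/negP => dpos.
pose gam (s : R) : R * V := (t, x + s *: (a *: basis_vec R i)).
have cgam : continuous gam.
  have -> : gam = (fun s => (t, x) + s *: (0, a *: basis_vec R i)).
    by apply/funext => s; congr pair; rewrite /= scaler0 addr0.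
  by move=> s; apply: cvgD; [exact: cvg_cst|exact: scalel_continuous].
have gamQ (s : R) : `[0, 1]%classic s -> Q (gam s).
  rewrite /= in_itv /= => /andP[s0 s1].
  move: s0; rewrite le_eqVlt => /orP[/eqP<-|s0]; first by rewrite scale0r addr0.
  by apply: funnel_closure; apply: lineO; rewrite s0.
have c1 := within_continuous_comp cgam gamQ (within_continuousZ (c := a) (cdz i)).
have [r r0 rP] : exists2 r : R, 0 < r & forall s, 0 <= s <= 1 -> `|s| < r ->
    0 < a * dz t (x + s *: (a *: basis_vec R i)) 0 i.
  move/subspace_continuousP : c1 => /(_ 0); rewrite /= in_itv /= lexx ler01 => /(_ isT).
  have dpos0 : 0 < a * dz t (x + 0 *: (a *: basis_vec R i)) 0 i.
    by rewrite scale0r addr0.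
  move=> /cvgr_gt /(_ _ dpos0) [r /= r0 rP].
  exists r => // s s01 sr; have := rP s; rewrite /= sub0r normrN in_itv /=.
  by move=> /(_ sr s01).
pose s := Num.min r 1 / 2.
have m0 : 0 < Num.min r 1 by rewrite lt_min r0 ltr01.
have [sr s1] : s < r /\ s < 1.
  have : s < Num.min r 1 by rewrite /s; lra.
  by rewrite lt_min => /andP[].
have s0 : 0 < s by rewrite /s; lra.
have gder y : y \in `]0, s[ -> is_derive y 1
    (fun s => z t (x + s *: (a *: basis_vec R i)))
    (a * dz t (x + y *: (a *: basis_vec R i)) 0 i).
  rewrite in_itv /= => /andP[y0 ys].
  have Oy : funnel h (x + y *: (a *: basis_vec R i)) by apply: lineO; lra.
  have d1 := dzP t _ i Oy.
  rewrite (_ : (fun _ => _) =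
    (fun s => z t (x + s *: basis_vec R i)) \o ( *%R a)); last first.
    by apply/funext => r' /=; rewrite scalerA mulrC.
  rewrite mulrC; apply: is_derive1_comp.
    by apply: is_derive_line; move: d1; rewrite scalerA mulrC.
  by apply: (is_derive_eq (is_deriveZ a (is_derive_id y 1))); rewrite [LHS]mulr1.
have gcont : {within `[0, s], continuous (fun s => z t (x + s *: (a *: basis_vec R i)))}.
  apply: continuous_subspaceW (within_continuous_comp cgam gamQ cz).
  by apply: subset_itvl; rewrite bnd_simp ltW.
have [y /[!in_itv] /= ys yE] := MVT s0 gder gcont.
have zs : z t (x + s *: (a *: basis_vec R i)) <= z t x.
  by apply: zmax; apply: funnel_closure; apply: lineO; lra.
move: yE; rewrite scale0r addr0 subr0 => yE.
have : 0 < a * dz t (x + y *: (a *: basis_vec R i)) 0 i * s.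
  by rewrite mulr_gt0 // rP ?ger0_norm; lra.
by rewrite -yE; lra.
Qed.

(* Only coordinate directions are needed to test the normal derivative: since h
   is nondecreasing, moving along e_1, or shrinking one coordinate of x', goes
   into the funnel. *)
Lemma boundary_maximum : bdry (funnel h) x -> 0 <= edot (outward_normal h x) (dz t x).
Proof.
move=> bx; have cx : closure (funnel h) x by case: bx.
move/(bdry_funnel hc h0): bx => bx.
rewrite edot_outward_normal mulr_ge0 ?(ltW (outward_normal_scale_gt0 _)) // addr_ge0 //.
  apply: sumr_ge0 => i _; rewrite mulrAC divr_ge0 ?enorm_ge0 // -oppr_le0 -mulNr.
  have [xi0|xi0] := eqVneq (sndc x 0 i) 0; first by rewrite xi0 oppr0 mul0r.
  apply: boundary_maximum_coord => // s s01; rewrite /funnel /=.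
  have -> : fstc (x + s *: (- sndc x 0 i *: basis_vec R (lift ord0 i))) = fstc x.
    by rewrite /fstc !mxE /= !mulr0 addr0.
  rewrite -bx ltr_sqrt; last first.
    rewrite /edot (bigD1 i) //= ltr_wpDr ?sumr_ge0 //.
      by move=> j _; rewrite -expr2 sqr_ge0.
    by rewrite -expr2 lt0r sqrf_eq0 xi0 sqr_ge0.
  rewrite /edot (bigD1 i) //= [ltRHS](bigD1 i) //=; apply: ltr_leD.
    rewrite !mxE !eqxx /= mulr1 -!expr2.
    move: xi0; rewrite mxE; set y := x 0 _ => y0.
    rewrite (_ : y + s * - y = (1 - s) * y); last by ring.
    by rewrite exprMn gtr_pMl ?lt0r ?sqrf_eq0 ?y0 ?sqr_ge0 //; nra.
  apply: ler_sum => j ji; rewrite !mxE (inj_eq lift_inj) (negbTE ji) /=.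
  by rewrite !mulr0 addr0.
rewrite oppr_ge0; have := profile_derive_ge0 hh (fstc x).
rewrite le_eqVlt => /orP[/eqP<-|hpos]; first by rewrite mul0r.
rewrite pmulr_rle0 // -[X in X <= _]mul1r; apply: boundary_maximum_coord => // s s01.
rewrite /funnel /= scale1r.
have -> : sndc (x + s *: basis_vec R ord0) = sndc x.
  by apply/rowP => j; rewrite !mxE /= mulr0 addr0.
rewrite bx; apply: (profile_increasing_after hh hpos).
by rewrite /fstc !mxE !eqxx /= mulr1; lra.
Qed.

End MaximumPoints.

Lemma compact_funnel_ball (p : V) (rho : R) :
  compact [set x : V | closure (funnel h) x /\ \sum_i (x 0 i - p 0 i) ^+ 2 <= rho].
Proof.
have cq : continuous (fun x : V => \sum_i (x 0 i - p 0 i) ^+ 2).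
  apply: (@continuous_big R _ +%R 0 xpredT add_continuous) => i _ x.
  have c1 : {for x, continuous (fun x : V => x 0 i - p 0 i)}.
    apply: (@continuousB _ _ _ (fun x : V => x 0 i) (cst (p 0 i))).
      exact: coord_continuous.
    exact: cst_continuous.
  exact: (cvgM c1 c1).
apply: bounded_closed_compact.
  exists (`|p| + (1 + `|rho|)); split; first exact: num_real.
  move=> M pM x [_ xrho]; apply: rV_norm_le.
    by apply: le_trans (ltW pM); rewrite addr_ge0 // addr_ge0.
  move=> i; apply: le_trans (ltW pM).
  rewrite -(subrK (p 0 i) (x 0 i)) addrC; apply: le_trans (ler_normD _ _) _.
  apply: lerD; first exact: coord_le_norm.
  have : (x 0 i - p 0 i) ^+ 2 <= `|rho|.
    apply: le_trans (ler_norm rho); apply: le_trans xrho.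
    by rewrite (bigD1 i) //= lerDl sumr_ge0 // => j _; rewrite sqr_ge0.
  have y0 := normr_ge0 (x 0 i - p 0 i); have r0 := normr_ge0 rho.
  by rewrite -real_normK ?num_real //; nra.
apply: closedI; first exact: closed_closure.
apply: (@preimage_closed _ _ (fun x : V => \sum_i (x 0 i - p 0 i) ^+ 2) [set r | r <= rho]).
  by move=> x _; exact: cq.
exact: closed_le.
Qed.

(* The barrier |x - p|^2 + (2N + 1) t, with p the star center, has a positive
   normal derivative; it localizes the maximum and makes the inequalities
   strict. *)
Lemma comparison (w wt : R -> V -> R) (dw d2w : R -> V -> V) (t0 t1 m B : R) :
  regular (funnel h) w wt dw d2w -> 0 <= m ->
  (forall t x, t0 <= t <= t1 -> closure (funnel h) x -> w t x <= B) ->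
  (forall x, closure (funnel h) x -> w t0 x <= m) ->
  (forall t x, t0 < t <= t1 -> funnel h x -> 0 < w t x ->
     wt t x <= \sum_i d2w t x 0 i) ->
  (forall t x, t0 < t <= t1 -> bdry (funnel h) x -> 0 < w t x ->
     edot (outward_normal h x) (dw t x) <= 0) ->
  forall t x, t0 <= t <= t1 -> closure (funnel h) x -> w t x <= m.
Proof.
move=> wreg m0 wB w0 wint wbd th xh th01 cxh; rewrite leNgt; apply/negP => whm.
have [p0 starP] := profile_star_shaped hh halpha hrad.
pose p : V := p0 *: basis_vec R ord0.
(* The Laplacian of |x - p|^2 is 2N; the extra 1 makes the interior inequality strict. *)
pose k : R := 2 * n.+1%:R + 1.
have k0 : 0 < k by rewrite /k ltr_wpDl // mulr_ge0.
pose z (t : R) (x : V) := k * t0 + (- k) * t - \sum_i 1 * (x 0 i - p 0 i) ^+ 2.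
have zle t x : t0 <= t -> z t x <= - \sum_i (x 0 i - p 0 i) ^+ 2.
  move=> tt0; rewrite /z; under eq_bigr do rewrite mul1r.
  have : k * t0 <= k * t by rewrite ler_wpM2l // ltW.
  lra.
have zle0 t x : t0 <= t -> z t x <= 0.
  move=> /zle zx; apply: le_trans (zx x) _; rewrite oppr_le0 sumr_ge0 // => i _.
  exact: sqr_ge0.
have zh0 : z th xh <= 0 by apply: zle0; lra.
(* With this weight the barrier costs less than half of the excess of w over m at the point under
   test. *)
pose eta := (w th xh - m) / (2 * (1 - z th xh)).
have eta0 : 0 < eta by rewrite divr_gt0 // ?subr_gt0 //; lra.
have etah : m < w th xh + eta * z th xh.
  have e1 : eta * (2 * (1 - z th xh)) = w th xh - m.
    by rewrite /eta divfK // gt_eqF //; lra.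
  lra.
have := @regular_quadratic R n (funnel h) (fun=> 1) p (k * t0) (- k).
move=> /(regular_addZ eta wreg) Zreg; set Z := (fun t x => _) in Zreg.
have ZE t x : Z t x = w t x + eta * z t x by [].
(* Outside this compact set the penalty exceeds B - m, so the penalized function cannot be above m
   there. *)
pose K := `[t0, t1]%classic `*`
  [set x : V | closure (funnel h) x /\ \sum_i (x 0 i - p 0 i) ^+ 2 <= (B - m) / eta].
have cK : compact K by apply: compact_setX; [exact: segment_compact|exact: compact_funnel_ball].
have inK t x : t0 <= t <= t1 -> closure (funnel h) x -> m < Z t x -> K (t, x).
  move=> t01 cx mZ; split; first by rewrite /= in_itv.
  split=> //; rewrite ler_pdivlMr //.
  have tt0 : t0 <= t by lra.
  have := zle t x tt0; rewrite -(ler_pM2l eta0) => z1.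
  by have := wB t x t01 cx; move: mZ; rewrite ZE; lra.
have Kh : K (th, xh) by exact: inK.
have cZ : {within K, continuous (fun q : R * V => Z q.1 q.2)}.
  case: Zreg => cZ _ _ _ _; apply: continuous_subspaceW cZ.
  by move=> q [_ []].
have [[ts xs]] := compact_EVT_max (ex_intro _ (th, xh) Kh) cK cZ.
rewrite inE => -[/=]; rewrite in_itv /= => ts01 [cxs _] Zmax.
have Zsm : m < Z ts xs by apply: lt_le_trans etah _; apply: (Zmax (th, xh)); rewrite inE.
have Zmax' t x : t0 <= t <= t1 -> closure (funnel h) x -> Z t x <= Z ts xs.
  move=> t01 cx; have [mZ|Zm] := ltP m (Z t x); last exact: le_trans (ltW Zsm).
  by apply: (Zmax (t, x)); rewrite inE; exact: inK.
have zs0 : eta * z ts xs <= 0 by rewrite pmulr_rle0 // zle0 //; lra.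
(* Since m >= 0 and the barrier is nonpositive, w > 0 at the maximum point: the differential
   inequalities, assumed only where w > 0, apply. *)
have ws0 : 0 < w ts xs by move: Zsm; rewrite ZE; lra.
have tst0 : t0 < ts <= t1.
  have /andP[t0s ->] := ts01; rewrite andbT lt_neqAle t0s andbT.
  apply/eqP => t0E; have := w0 xs cxs; move: Zsm zs0; rewrite ZE -t0E; lra.
have zmaxs y : closure (funnel h) y -> Z ts y <= Z ts xs by exact: Zmax'.
case: (closure_funnelP hc h0 cxs) => [Os|bs].
  have D2 i := interior_maximum Zreg zmaxs i Os.
  have [_ _ /(_ ts xs Os) ZtP _ _] := Zreg.
  have e0 : 0 < ts - t0 by lra.
  have : 0 <= wt ts xs + eta * - k.
    apply: (is_derive_left_max e0 ZtP) => s sts; apply: Zmax' => //; lra.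
  have : \sum_i (d2w ts xs + eta *: \row_i (- 2 * 1)) 0 i <= 0.
    by apply: sumr_le0 => i _; exact: D2.
  have -> : \sum_i (d2w ts xs + eta *: \row_i (- 2 * 1)) 0 i =
      \sum_i d2w ts xs 0 i - eta * (2 * n.+1%:R).
    under eq_bigr do rewrite !mxE.
    rewrite big_split /= sumr_const card_ord -mulr_natr; congr (_ + _); ring.
  by have := wint ts xs tst0 Os ws0; rewrite /k; lra.
have := boundary_maximum Zreg zmaxs bs.
rewrite leNgt => /negP; apply.
have wb := wbd ts xs tst0 bs ws0.
pose dz : V := \row_i (- 2 * 1 * (xs 0 i - p 0 i)).
have -> : edot (outward_normal h xs) (dw ts xs + eta *: dz) =
    edot (outward_normal h xs) (dw ts xs) + eta * edot (outward_normal h xs) dz.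
  rewrite /edot mulr_sumr -big_split /=; apply: eq_bigr => i _; rewrite !mxE; ring.
(* On the boundary |x'| = h, and up to a positive factor this product is -2 (h - h' (x_1 - p)),
   negative by star-shapedness. *)
suff : edot (outward_normal h xs) dz < 0.
  by rewrite -(pmulr_rlt0 _ eta0); lra.
rewrite edot_outward_normal pmulr_rlt0 ?outward_normal_scale_gt0 //.
have -> : \sum_i sndc xs 0 i / enorm (sndc xs) * dz 0 (lift ord0 i) = - 2 * h (fstc xs).
  have hE := (bdry_funnel hc h0 xs).1 bs.
  transitivity (- 2 / enorm (sndc xs) * edot (sndc xs) (sndc xs)).
    rewrite /edot mulr_sumr; apply: eq_bigr => i _.
    by rewrite !mxE /= mulr0 subr0; ring.
  by rewrite -enorm_sqr hE expr2 mulrA divfK // gt_eqF // profile_gt0.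
rewrite !mxE eqxx /= !mulr1; have := starP (fstc xs); rewrite /fstc; lra.
Qed.

End Comparison.

(** * Positivity *)

Section Positivity.
Variables (R : realType) (n : nat) (rad alpha : R) (h : R -> R).
Hypothesis hrad : 0 < rad.
Hypothesis halpha : 0 < alpha < pi / 2.
Hypothesis hh : funnel_profile rad alpha h.
Notation V := 'rV[R]_n.+1.

Let hc := profile_continuous hh.
Let h0 := profile_gt0 hh.

Lemma classical_solution_regular (f : R -> R) (u : R -> V -> R) :
  classical_solution f h u -> exists ut du d2u,
  [/\ regular (funnel h) u ut du d2u,
      forall t x, funnel h x -> ut t x = \sum_i d2u t x 0 i + f (u t x) &
      forall t x, bdry (funnel h) x -> edot (outward_normal h x) (du t x) = 0].
Proof.
move=> [ut [Du [D2u [[cu _ cDu _] [utP DuP D2uP] eqn bd]]]].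
exists ut, Du, (fun t x => \row_i D2u t x i i); split=> //.
- split=> //; last by move=> t x i Ox; rewrite mxE; exact: D2uP.
  move=> i p; apply: (@continuous_comp _ _ _ _ (fun y : V => y 0 i)); first exact: cDu.
  exact: coord_continuous.
- move=> t x Ox; rewrite eqn; last exact: funnel_closure.
  by rewrite /mxtrace; congr (_ + _); apply: eq_bigr => i _; rewrite mxE.
Qed.

(** Its sublevel sets are ellipsoids centered on the axis at x_1 = p; a small k stretches them along
    x_1 and makes the x_1 component of the gradient small. *)
Definition slab_quadratic (k p : R) (x : V) : R :=
  k ^+ 2 * (fstc x - p) ^+ 2 + enorm (sndc x) ^+ 2.

Definition slab_bump (k p sg t0 t : R) (x : V) : R :=
  1 + sg * (t - t0) - slab_quadratic k p x.

Definition slab_grad (k p : R) (x : V) : V :=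
  mkpoint (- 2 * k ^+ 2 * (fstc x - p)) (- 2 *: sndc x).

Lemma slab_quadratic_ge0 (k p : R) (x : V) : 0 <= slab_quadratic k p x.
Proof. by apply: addr_ge0; [apply: mulr_ge0; exact: sqr_ge0|exact: sqr_ge0]. Qed.

Lemma slab_bump_regular (k p sg t0 : R) :
  regular (funnel h) (slab_bump k p sg t0) (fun _ _ => sg) (fun _ => slab_grad k p)
    (fun _ _ => mkpoint (- 2 * k ^+ 2) (const_mx (- 2))).
Proof.
pose a (i : 'I_n.+1) : R := if i == ord0 then k ^+ 2 else 1.
pose P : V := p *: basis_vec R ord0.
have PE i : P 0 i = if i == ord0 then p else 0.
  by rewrite !mxE eqxx /=; case: (i == ord0); rewrite ?mulr1 ?mulr0.
have := @regular_quadratic R n (funnel h) a P (1 - sg * t0) sg.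
congr (regular _ _ _ _ _).
- apply/funext => t; apply/funext => x; rewrite /slab_bump /slab_quadratic.
  rewrite big_ord_recl PE /a /= -/(fstc x) enorm_sqr /edot.
  rewrite (_ : \sum_(i < n) _ = \sum_i sndc x 0 i * sndc x 0 i); first by ring.
  by apply: eq_bigr => i _; rewrite PE /= !mxE subr0 mul1r expr2.
- apply/funext => t; apply/funext => x; apply/rowP => i; rewrite !mxE /a.
  by case: (unliftP ord0 i) => [j|] ->; rewrite ?unlift_none ?liftK /= ?mxE ?mulr0 ?subr0 ?mulr1.
- apply/funext => t; apply/funext => x; apply/rowP => i; rewrite !mxE /a.
  by case: (unliftP ord0 i) => [j|] ->; rewrite ?unlift_none ?liftK /= ?mxE ?mulr1.
Qed.

(** The gradient is nonzero away from the center. In the Laplacian of the cube, the term 6 z |grad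
    z|^2 therefore dominates where z is small. *)
Lemma slab_grad_sqr_ge (k p : R) (x : V) : 0 < k <= 1 ->
  4 * k ^+ 2 * slab_quadratic k p x <= \sum_i slab_grad k p x 0 i ^+ 2.
Proof.
move=> /andP[k0 k1]; have k21 : k ^+ 2 <= 1 by nra.
rewrite big_ord_recl mxE unlift_none /=.
have -> : \sum_(i < n) slab_grad k p x 0 (lift ord0 i) ^+ 2 = 4 * enorm (sndc x) ^+ 2.
  rewrite enorm_sqr /edot mulr_sumr; apply: eq_bigr => i _.
  by rewrite mxE liftK /= mxE; ring.
rewrite /slab_quadratic; have := sqr_ge0 (enorm (sndc x)); have := sqr_ge0 k.
by move: k21; set a := enorm _ ^+ 2; set b := k ^+ 2; nra.
Qed.

(** On the wall the radial part contributes -2 h <= -2 rad, and the x_1 part at most 2 k (k |x_1 -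
    p|) tan(alpha) <= 2 k r tan(alpha). The condition r >= 1 turns (k |x_1 - p|)^2 <= r into k |x_1
    - p| <= r. *)
Lemma slab_grad_normal_le0 (k p r : R) (x : V) : 0 < k -> 1 <= r ->
  k * r * tan alpha <= rad -> bdry (funnel h) x -> slab_quadratic k p x <= r ->
  edot (outward_normal h x) (slab_grad k p x) <= 0.
Proof.
move=> k0 r1 kr bx qr; have hE := (bdry_funnel hc h0 x).1 bx.
rewrite edot_outward_normal pmulr_rle0 ?outward_normal_scale_gt0 //.
have -> : \sum_i sndc x 0 i / enorm (sndc x) * slab_grad k p x 0 (lift ord0 i) =
    - 2 * h (fstc x).
  transitivity (- 2 / enorm (sndc x) * edot (sndc x) (sndc x)).
    rewrite /edot mulr_sumr; apply: eq_bigr => i _.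
    by rewrite [slab_grad _ _ _ _ _]mxE liftK /= !mxE; ring.
  by rewrite -enorm_sqr hE expr2 mulrA divfK // gt_eqF // profile_gt0.
rewrite mxE unlift_none /=.
have kx : k * `|fstc x - p| <= r.
  have kx2 : (k * `|fstc x - p|) ^+ 2 <= r.
    rewrite exprMn real_normK ?num_real //; apply: le_trans qr.
    by rewrite lerDl sqr_ge0.
  have kx0 : 0 <= k * `|fstc x - p| by rewrite mulr_ge0 // ltW.
  by move: kx2 kx0 r1; set q := k * _; nra.
have dh0 := profile_derive_ge0 hh (fstc x).
have dh1 := profile_derive_le hh (fstc x).
have hr := profile_ge_rad hh (fstc x).
have : k ^+ 2 * (fstc x - p) * derive1 h (fstc x) <= k * r * tan alpha.
  apply: (@le_trans _ _ (k * (k * `|fstc x - p|) * derive1 h (fstc x))).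
    rewrite ler_wpM2r // expr2 -!mulrA !ler_wpM2l ?(ltW k0) //.
    exact: ler_norm.
  apply: ler_pM => //; first by rewrite !mulr_ge0 ?(ltW k0).
  by rewrite ler_wpM2l ?(ltW k0).
by move: hr kr; lra.
Qed.

(* After division by E z, the difference of both sides is bounded above by a
   quadratic polynomial in z whose discriminant vanishes for this choice of m. *)
Lemma barrier_inequality (E z k sg S G K cw cwt cL : R) :
  0 < E -> 0 < z -> 0 < k -> 0 <= K -> 4 * k ^+ 2 * (1 - z) <= G ->
  cw < E * (z * z * z) -> cL - K * cw <= cwt ->
  E * (- (K + (3 * sg + 3 * S + 24 * k ^+ 2) ^+ 2 / (96 * k ^+ 2)) * (z * z * z) +
    3 * z ^+ 2 * sg) - cwt <= E * (6 * z * G - 3 * z ^+ 2 * S) - cL.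
Proof.
move=> E0 z0 k0 K0 zG cwz cwL; have k20 : 0 < k ^+ 2 by rewrite exprn_gt0.
(* The gradient bound times 6 gives 24 k^2 (1 - z), and D = C^2 / (4 * 24 k^2) cancels the
   discriminant of D z^2 - C z + 24 k^2. *)
set C := 3 * sg + 3 * S + 24 * k ^+ 2; set D := C ^+ 2 / (96 * k ^+ 2).
have DE : D * (96 * k ^+ 2) = C ^+ 2 by rewrite /D divfK // gt_eqF // mulr_gt0.
have key : 0 <= D * z ^+ 2 - C * z + 24 * k ^+ 2.
  suff : 0 <= (D * z ^+ 2 - C * z + 24 * k ^+ 2) * (96 * k ^+ 2).
    by rewrite pmulr_lge0 // mulr_gt0.
  rewrite (_ : _ * (96 * k ^+ 2) = (C * z - 48 * k ^+ 2) ^+ 2) ?sqr_ge0 //.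
  rewrite (_ : _ * _ = D * (96 * k ^+ 2) * z ^+ 2 + (- C * z + 24 * k ^+ 2) * (96 * k ^+ 2)).
    by rewrite DE; ring.
  by ring.
have key2 : 0 <= E * z * (D * z ^+ 2 - 3 * sg * z - 3 * S * z + 6 * G).
  rewrite mulr_ge0 ?mulr_ge0 ?(ltW E0) ?(ltW z0) //.
  by move: key zG; rewrite /C; lra.
have KcW : K * cw <= K * (E * (z * z * z)) by rewrite ler_wpM2l // ltW.
by move: key2 KcW cwL; lra.
Qed.

(* The subsolution is E(t) z^3 with E(t) = exp(- m (t - t0)) and
   z = 1 + sg (t - t0) - k^2 (x_1 - p)^2 - |x'|^2, where z > 0; a small k makes
   this ellipsoid so flat that the boundary condition holds. *)
Lemma spreading_positivity (w wt : R -> V -> R) (dw d2w : R -> V -> V)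
    (t0 K dl k p sg : R) :
  regular (funnel h) w wt dw d2w -> 0 <= K -> 0 < dl -> 0 < k <= 1 -> 0 <= sg ->
  k * (1 + sg) * tan alpha <= rad ->
  (forall t x, t0 <= t <= t0 + 1 -> closure (funnel h) x -> 0 <= w t x) ->
  (forall t x, t0 < t <= t0 + 1 -> funnel h x ->
     \sum_i d2w t x 0 i - K * w t x <= wt t x) ->
  (forall t x, t0 < t <= t0 + 1 -> bdry (funnel h) x ->
     0 <= edot (outward_normal h x) (dw t x)) ->
  (forall x, closure (funnel h) x -> k ^+ 2 * (fstc x - p) ^+ 2 < 1 -> dl <= w t0 x) ->
  forall x, closure (funnel h) x -> slab_quadratic k p x < 1 + sg -> 0 < w (t0 + 1) x.
Proof.
move=> wreg K0 dl0 k01 sg0 ksg wge0 wint wbd winit xh cxh qxh.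
have /andP[k0 k1] := k01.
(* Minus the Laplacian of the bump. *)
pose S : R := 2 * (k ^+ 2 + n%:R).
pose m : R := K + (3 * sg + 3 * S + 24 * k ^+ 2) ^+ 2 / (96 * k ^+ 2).
have m0 : 0 <= m.
  by rewrite addr_ge0 // divr_ge0 ?sqr_ge0 // mulr_ge0 // sqr_ge0.
pose z := slab_bump k p sg t0.
pose E (t : R) := expR (- m * (t - t0)).
have E0 (t : R) : 0 < E t by exact: expR_gt0.
have E1 (t : R) : t0 <= t -> E t <= 1.
  by move=> tt0; rewrite -expR0 ler_expR mulNr oppr_le0 mulr_ge0 // subr_ge0.
(* Rescaling w by 1 / dl makes it at least 1 on the initial ellipsoid, where z^3 <= 1. *)
have c0 : 0 < dl^-1 by rewrite invr_gt0.
have cw0 (t : R) (x : V) : t0 <= t <= t0 + 1 -> closure (funnel h) x ->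
    0 <= dl^-1 * w t x.
  by move=> t01 cx; rewrite mulr_ge0 ?(ltW c0) // wge0.
have := regular_addZ (- dl^-1) (regular_expM (- m) t0
  (regular_cube (slab_bump_regular k p sg t0))) wreg.
rewrite -/z -/E => Wreg.
have zpos (t : R) (x : V) : t0 <= t <= t0 + 1 -> closure (funnel h) x ->
    dl^-1 * w t x < E t * (z t x * z t x * z t x) -> 0 < z t x.
  move=> t01 cx /(le_lt_trans (cw0 t x t01 cx)); rewrite pmulr_rgt0 // -expr2.
  by have := sqr_ge0 (z t x); rewrite le_eqVlt => /orP[/eqP<-|/pmulr_rgt0 ->//];
    rewrite mul0r ltxx.
have zle (t : R) (x : V) : t0 <= t <= t0 + 1 -> z t x <= 1 + sg.
  move=> t01; have sgt : sg * (t - t0) <= sg * 1 by rewrite ler_wpM2l //; move: t01; lra.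
  by have := slab_quadratic_ge0 k p x; rewrite /z /slab_bump; move: sgt; lra.
have cube_le (a b : R) : 0 < a -> a <= b -> a * a * a <= b * b * b.
  by move=> a0 ab; rewrite !ler_pM ?mulr_ge0 ?(ltW a0).
have WE (t : R) (x : V) : E t * (z t x * z t x * z t x) + - dl^-1 * w t x =
    E t * (z t x * z t x * z t x) - dl^-1 * w t x by rewrite mulNr.
have t1 : t0 <= t0 + 1 <= t0 + 1 by rewrite lexx lerDl ler01.
have : E (t0 + 1) * (z (t0 + 1) xh * z (t0 + 1) xh * z (t0 + 1) xh) +
    - dl^-1 * w (t0 + 1) xh <= 0.
  apply: (comparison hrad halpha hh (B := (1 + sg) * (1 + sg) * (1 + sg))
    Wreg (lexx 0) _ _ _ _ t1 cxh).
  - move=> t x t01 cx; rewrite WE lerBlDr ler_wpDr ?cw0 //.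
    have [z0|z0] := ltP 0 (z t x); last first.
      apply: (@le_trans _ _ 0); last by rewrite !mulr_ge0 // addr_ge0.
      by rewrite pmulr_rle0 // mulr_ge0_le0 // -expr2 sqr_ge0.
    apply: le_trans (cube_le _ _ z0 (zle t x t01)).
    by rewrite ler_piMl ?E1 ?mulr_ge0 ?(ltW z0) //; have /andP[] := t01.
  - move=> x cx; rewrite WE subr_le0 leNgt; apply/negP => Wpos.
    have t01 : t0 <= t0 <= t0 + 1 by rewrite lexx lerDl ler01.
    have z0 := zpos t0 x t01 cx Wpos.
    have zE : z t0 x = 1 - slab_quadratic k p x by rewrite /z /slab_bump subrr mulr0 addr0.
    have z1 : z t0 x <= 1 by rewrite zE gerBl slab_quadratic_ge0.
    have dw0 : dl <= w t0 x.
      apply: winit => //; apply: (@le_lt_trans _ _ (slab_quadratic k p x)).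
        by rewrite lerDl sqr_ge0.
      by move: z0; rewrite zE subr_gt0.
    have cw1 : 1 <= dl^-1 * w t0 x by rewrite mulrC ler_pdivlMr // mul1r.
    move: (cube_le _ _ z0 z1) Wpos cw1.
    by rewrite /E subrr mulr0 expR0 mul1r !mulr1; lra.
  - move=> t x t01 Ox; rewrite WE subr_gt0 => Wpos.
    have t01' : t0 <= t <= t0 + 1 by have /andP[/ltW-> ->] := t01.
    have z0 := zpos t x t01' (funnel_closure Ox) Wpos.
    have -> : \sum_i (E t *: (\row_i (6 * z t x * slab_grad k p x 0 i ^+ 2 +
        3 * z t x ^+ 2 * mkpoint (- 2 * k ^+ 2) (const_mx (- 2)) 0 i)) +
        (- dl^-1) *: d2w t x) 0 i =
        E t * (6 * z t x * (\sum_i slab_grad k p x 0 i ^+ 2) - 3 * z t x ^+ 2 * S)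
        - dl^-1 * \sum_i d2w t x 0 i.
      have -> : S = - \sum_(i < n.+1) mkpoint (- 2 * k ^+ 2) (const_mx (- 2)) 0 i.
        rewrite big_ord_recl mxE unlift_none /=; under eq_bigr do rewrite mxE liftK /= mxE.
        by rewrite sumr_const card_ord -mulr_natr /S; ring.
      rewrite mulrN opprK !mulr_sumr -big_split /= mulr_sumr -sumrB.
      by apply: eq_bigr => i _; rewrite !mxE; ring.
    have zG : 4 * k ^+ 2 * (1 - z t x) <= \sum_i slab_grad k p x 0 i ^+ 2.
      apply: le_trans (slab_grad_sqr_ge p x k01).
      apply: ler_wpM2l; first by rewrite mulr_ge0 // sqr_ge0.
      have : 0 <= sg * (t - t0) by rewrite mulr_ge0 // subr_ge0; have /andP[] := t01'.
      by rewrite /z /slab_bump; lra.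
    have cwL : dl^-1 * \sum_i d2w t x 0 i - K * (dl^-1 * w t x) <= dl^-1 * wt t x.
      by rewrite mulrCA -mulrBr ler_wpM2l ?(ltW c0) // wint.
    rewrite [- dl^-1 * _]mulNr.
    exact: (barrier_inequality sg S (E0 t) z0 k0 K0 zG Wpos cwL).
  - move=> t x t01 bx; rewrite WE subr_gt0 => Wpos.
    have t01' : t0 <= t <= t0 + 1 by have /andP[/ltW-> ->] := t01.
    have cx : closure (funnel h) x by case: bx.
    have z0 := zpos t x t01' cx Wpos.
    have -> : edot (outward_normal h x) (E t *: ((3 * z t x ^+ 2) *: slab_grad k p x) +
        (- dl^-1) *: dw t x) =
        E t * (3 * z t x ^+ 2) * edot (outward_normal h x) (slab_grad k p x) -
        dl^-1 * edot (outward_normal h x) (dw t x).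
      by rewrite /edot !mulr_sumr -sumrB; apply: eq_bigr => i _;
        rewrite !mxE; ring.
    rewrite subr_le0; apply: (@le_trans _ _ 0); last first.
      by rewrite mulr_ge0 ?(ltW c0) // wbd.
    apply: mulr_ge0_le0; first by rewrite !mulr_ge0 ?sqr_ge0 // ltW.
    apply: slab_grad_normal_le0 ksg bx _ => //; first by rewrite lerDl.
    have sgt : sg * (t - t0) <= sg * 1 by rewrite ler_wpM2l //; move: t01; lra.
    by move: z0 sgt; rewrite /z /slab_bump; lra.
rewrite WE subr_le0 => Wle.
have z1 : 0 < z (t0 + 1) xh.
  by rewrite /z /slab_bump [t0 + 1]addrC addrK mulr1 subr_gt0.
rewrite -(pmulr_rgt0 _ c0); apply: lt_le_trans Wle.
by rewrite !mulr_gt0.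
Qed.

(** Unit time suffices for every point because the stretching k and the growth rate may depend on
    the point: the initial ellipsoid touches the hyperplane x_1 = A from inside the half-space and
    grows until it covers x. *)
Lemma half_space_positivity (w wt : R -> V -> R) (dw d2w : R -> V -> V) (t0 K dl A : R) :
  regular (funnel h) w wt dw d2w -> 0 <= K -> 0 < dl ->
  (forall t x, t0 <= t <= t0 + 1 -> closure (funnel h) x -> 0 <= w t x) ->
  (forall t x, t0 < t <= t0 + 1 -> funnel h x ->
     \sum_i d2w t x 0 i - K * w t x <= wt t x) ->
  (forall t x, t0 < t <= t0 + 1 -> bdry (funnel h) x ->
     0 <= edot (outward_normal h x) (dw t x)) ->
  (forall x, closure (funnel h) x -> fstc x <= A -> dl <= w t0 x) \/
  (forall x, closure (funnel h) x -> A <= fstc x -> dl <= w t0 x) ->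
  forall x, closure (funnel h) x -> 0 < w (t0 + 1) x.
Proof.
move=> wreg K0 dl0 wge0 wint wbd winit x cx.
pose S := enorm (sndc x) ^+ 2.
have S0 : 0 <= S by rewrite sqr_ge0.
pose D : R := `|fstc x - A|.
have D0 : 0 <= D by exact: normr_ge0.
have ta0 : 0 <= tan alpha.
  exact: le_trans (profile_derive_ge0 hh 0) (profile_derive_le hh 0).
have den0 : 0 < (1 + tan alpha) * (6 + S) by rewrite mulr_gt0 //; lra.
(* The first bound gives k |x_1 - A| <= 1 and k <= 1; the second is the boundary condition for the
   final size 6 + S. *)
pose k := Num.min (1 + D)^-1 (rad / ((1 + tan alpha) * (6 + S))).
have k0 : 0 < k by rewrite lt_min invr_gt0 divr_gt0 // andbT; lra.
have kD : k * (1 + D) <= 1.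
  by rewrite -ler_pdivlMr ?div1r ?ge_min ?lexx //; lra.
have kR : k * ((1 + tan alpha) * (6 + S)) <= rad.
  by rewrite -ler_pdivlMr // ge_min lexx orbT.
have k1 : k <= 1 by nra.
have kR' : k * (1 + (5 + S)) * tan alpha <= rad.
  apply: le_trans kR; rewrite -mulrA ler_wpM2l ?(ltW k0) //.
  by rewrite mulrC; nra.
have kk1 : k * k^-1 = 1 by rewrite mulfV // gt_eqF.
suff [p pA pinit] : exists2 p, k * `|A - p| = 1 &
    forall y, closure (funnel h) y -> k ^+ 2 * (fstc y - p) ^+ 2 < 1 -> dl <= w t0 y.
  (* Since k |x_1 - p| <= 2, the quadratic form at x is at most 4 + S, below the final level 1 + (5
     + S). *)
  have sg0 : 0 <= 5 + S by lra.
  have k01 : 0 < k <= 1 by rewrite k0.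
  apply: (spreading_positivity wreg K0 dl0 k01 sg0 kR' wge0 wint wbd pinit cx).
  rewrite /slab_quadratic -/S -exprMn -real_normK ?num_real // normrM gtr0_norm //.
  have kx : k * `|fstc x - p| <= 2.
    have := ler_normD (fstc x - A) (A - p); rewrite addrA subrK -/D => tri.
    have : k * `|fstc x - p| <= k * (D + `|A - p|) by rewrite ler_wpM2l // ltW.
    by rewrite mulrDr pA; nra.
  have : 0 <= k * `|fstc x - p| by rewrite mulr_ge0 // ltW.
  by nra.
have half y p : k ^+ 2 * (y - p) ^+ 2 < 1 -> `|y - p| < k^-1.
  rewrite -exprMn -real_normK ?num_real // normrM (gtr0_norm k0) => ky.
  rewrite -[k^-1]mul1r ltr_pdivlMr // mulrC.
  have : 0 <= k * `|y - p| by rewrite mulr_ge0 // ltW.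
  by move: ky; set q := k * _; nra.
have ki0 : 0 < k^-1 by rewrite invr_gt0.
case: winit => winit; [exists (A - k^-1) | exists (A + k^-1)].
- by rewrite opprB addrC subrK gtr0_norm.
- by move=> y cy /half; rewrite ltr_norml => ?; apply: winit => //; lra.
- by rewrite opprD addrA subrr sub0r normrN gtr0_norm.
- by move=> y cy /half; rewrite ltr_norml => ?; apply: winit => //; lra.
Qed.

End Positivity.

(** * The front-like solution *)

Section FrontLike.
Variables (R : realType) (n : nat) (f : R -> R) (theta c : R) (phi : R -> R).
Variables (rad alpha : R) (h : R -> R) (u : R -> 'rV[R]_n.+1 -> R).
Hypothesis hf : bistable f theta.
Hypothesis hphi : planar_front f theta c phi.
Hypothesis hrad : 0 < rad.
Hypothesis halpha : 0 < alpha < pi / 2.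
Hypothesis hh : funnel_profile rad alpha h.
Hypothesis hu : front_like_solution f c phi h u.
Notation V := 'rV[R]_n.+1.

Let c0 : 0 < c := front_speed_gt0 hf hphi.

Let u01 (t : R) (x : V) : closure (funnel h) x -> 0 <= u t x <= 1.
Proof. by case: hu => _ + _; exact. Qed.

Lemma front_like_near_front (eps : R) : 0 < eps -> exists T, forall t x, t <= T ->
  closure (funnel h) x -> `|u t x - phi (fstc x - c * t)| <= eps.
Proof.
move=> e0; case: hu => _ _ /(_ _ e0) [M [_ MP]].
by exists (M - 1) => t x tM cx; apply: MP => //; lra.
Qed.

(** By compactness a shifted front exceeds the original by a fixed amount on a bounded range, which
    beats a small enough approximation error. *)
Lemma front_gap (d L U : R) : 0 < d -> L <= U -> exists2 k : R, 0 < k &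
  forall z, L <= z <= U -> k <= phi (z - d) - phi z.
Proof.
move=> d0 LU; have phic : continuous phi.
  case: hphi => phid _ _ _ _ z; apply: differentiable_continuous.
  by apply/derivable1_diffP; exact: (phid z).1.
have cg : continuous (fun z => phi (z - d) - phi z).
  move=> z; apply: cvgB; last exact: phic.
  apply: (@continuous_comp _ _ _ (fun z => z - d) phi); last exact: phic.
  by apply: cvgB; [exact: cvg_id|exact: cvg_cst].
have [m _ mP] := EVT_min LU (continuous_subspaceT cg).
exists (phi (m - d) - phi m).
  by rewrite subr_gt0 (front_decreasing hf hphi) // ltrBlDr ltrDl.
by move=> z zLU; apply: mP; rewrite in_itv.
Qed.

(* While u is close to the front, u(t, x) > u(t + s, x) is possible only where
   both values lie in an interval on which f is nonincreasing, so that the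
   difference satisfies the maximum principle with an initial size that
   tends to 0. *)
Lemma front_like_nondecreasing_early (s : R) : 0 < s -> exists T, forall t x, t <= T ->
  closure (funnel h) x -> u t x <= u (t + s) x.
Proof.
move=> s0; have [hcl _ _] := hu.
have [ut [du [d2u [ureg ueq ubd]]]] := classical_solution_regular hcl.
have d0 : 0 < c * s by rewrite mulr_gt0.
have [dl dl0 dlP] := bistable_nonincreasing_near_stable hf.
have dl20 : 0 < dl / 2 by rewrite divr_gt0.
have [A1 A1P] := front_near_pinfty hphi dl20.
have [A2 A2P] := front_near_ninfty hphi dl20.
pose L := A2; pose U := Num.max (A1 + c * s) L.
have LU : L <= U by rewrite le_max lexx orbT.
have UA : A1 + c * s <= U by rewrite le_max lexx.
have [k k0 kP] := front_gap d0 LU.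
(* The bound k / 3 leaves a positive gap after two errors, which excludes the middle range; dl / 2
   keeps both values within dl of 0 or 1 elsewhere. *)
pose e := Num.min (dl / 2) (k / 3).
have e0 : 0 < e by rewrite lt_min dl20 divr_gt0.
have [edl ek] : e <= dl / 2 /\ e <= k / 3 by rewrite !ge_min !lexx orbT.
have [T TP] := front_like_near_front e0.
have near1 t x : t <= T - s -> closure (funnel h) x -> u (t + s) x < u t x ->
    f (u t x) <= f (u (t + s) x).
  move=> tT cx uu; have tT1 : t <= T by lra.
  have tT2 : t + s <= T by lra.
  have h1 := TP t x tT1 cx; have h2 := TP (t + s) x tT2 cx.
  move: h1 h2; set z := fstc x - c * t.
  have -> : fstc x - c * (t + s) = z - c * s by rewrite /z; ring.
  rewrite !ler_norml => h1 h2.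
  have zout : z < L \/ U < z.
    have [zL|Lz] := ltP z L; first by left.
    right; rewrite ltNge; apply/negP => zU.
    have := kP z; rewrite Lz zU => /(_ isT); lra.
  have /andP[a0 _] := u01 (t + s) cx; have /andP[_ b1] := u01 t cx.
  apply: dlP => //; first exact: ltW.
  case: zout => zo; [right|left].
    have zA : z - c * s <= A2 by move: zo; rewrite /L; lra.
    have := A2P _ zA; lra.
  have zA : A1 <= z by lra.
  have := A1P _ zA; lra.
exists (T - s) => t x tT cx; rewrite -subr_le0 leNgt; apply/negP => Wpos.
(* Starting from a time when u is eps-close to the front, the comparison bounds the excess by 2 eps,
   that is, by half of itself. *)
pose eps := (u t x - u (t + s) x) / 4.
have eps0 : 0 < eps by rewrite divr_gt0.
have [T2 T2P] := front_like_near_front eps0.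
pose t0 := Num.min t (T2 - s).
have [t0t t0T] : t0 <= t /\ t0 <= T2 - s by rewrite !ge_min !lexx orbT.
have Wreg := regular_addZ (- 1) ureg (regular_shift s ureg).
have t01 : t0 <= t <= T - s by rewrite t0t tT.
have eps20 : 0 <= 2 * eps by rewrite mulr_ge0 // ltW.
have : u t x + -1 * u (t + s) x <= 2 * eps.
  apply: (comparison hrad halpha hh (B := 1) Wreg eps20 _ _ _ _ t01 cx).
  - move=> t' x' _ cx'; have := u01 t' cx'; have := u01 (t' + s) cx'; lra.
  - move=> x' cx'; have tT1 : t0 <= T2 by lra.
    have tT2 : t0 + s <= T2 by lra.
    have := T2P t0 x' tT1 cx'; have := T2P (t0 + s) x' tT2 cx'.
    have -> : fstc x' - c * (t0 + s) = fstc x' - c * t0 - c * s by ring.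
    have : phi (fstc x' - c * t0) < phi (fstc x' - c * t0 - c * s).
      by rewrite (front_decreasing hf hphi) // ltrBlDr ltrDl.
    by rewrite !ler_norml; lra.
  - move=> t' x' t01' Ox' W'; have t'T : t' <= T - s by case/andP: t01'.
    have uu : u (t' + s) x' < u t' x' by lra.
    have fle := near1 t' x' t'T (funnel_closure Ox') uu.
    have -> : \sum_i (d2u t' x' + -1 *: d2u (t' + s) x') 0 i =
        \sum_i d2u t' x' 0 i - \sum_i d2u (t' + s) x' 0 i.
      by rewrite -sumrB; apply: eq_bigr => i _; rewrite !mxE; ring.
    by rewrite !ueq //; lra.
  - move=> t' x' _ bx' _.
    have -> : edot (outward_normal h x') (du t' x' + -1 *: du (t' + s) x') =
        edot (outward_normal h x') (du t' x') - edot (outward_normal h x') (du (t' + s) x').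
      by rewrite /edot -sumrB; apply: eq_bigr => i _; rewrite !mxE; ring.
    by rewrite !ubd // subrr.
by rewrite /eps; lra.
Qed.

(** The ordering known at the early time T propagates by comparison of the difference multiplied by
    exp(-K (t - T)), where K is a Lipschitz constant of f on [0, 1]. *)
Lemma front_like_nondecreasing (t s : R) (x : V) : 0 <= s -> closure (funnel h) x ->
  u t x <= u (t + s) x.
Proof.
rewrite le_eqVlt => /orP[/eqP<-|s0] cx; first by rewrite addr0.
have [T TP] := front_like_nondecreasing_early s0.
have [tT|/ltW Tt] := leP t T; first exact: TP.
have [hcl _ _] := hu.
have [ut [du [d2u [ureg ueq ubd]]]] := classical_solution_regular hcl.
have [K K0 KP] := bistable_lipschitz hf.
have Wreg := regular_expM (- K) T (regular_addZ (- 1) ureg (regular_shift s ureg)).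
have t01 : T <= t <= t by rewrite Tt lexx.
have E0 (t' : R) : 0 < expR (- K * (t' - T)) by exact: expR_gt0.
have : expR (- K * (t - T)) * (u t x + -1 * u (t + s) x) <= 0.
  apply: (comparison hrad halpha hh (B := 1) Wreg (lexx 0) _ _ _ _ t01 cx).
  - move=> t' x' /andP[Tt' _] cx'.
    have E1 : expR (- K * (t' - T)) <= 1.
      by rewrite -expR0 ler_expR mulNr oppr_le0 mulr_ge0 // subr_ge0.
    have := u01 t' cx'; have := u01 (t' + s) cx' => h1 h2.
    have [w0|w0] := leP (u t' x' + -1 * u (t' + s) x') 0.
      by apply: le_trans ler01; rewrite pmulr_rle0.
    rewrite -[leRHS]mulr1; apply: ler_pM => //; first exact: ltW.
    by lra.
  - move=> x' cx'; rewrite pmulr_rle0 //.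
    by have := TP T x' (lexx T) cx'; lra.
  - move=> t' x' _ Ox'; rewrite pmulr_rgt0 // => W'.
    have cx' := funnel_closure Ox'.
    have -> : \sum_i (expR (- K * (t' - T)) *: (d2u t' x' + -1 *: d2u (t' + s) x')) 0 i =
        expR (- K * (t' - T)) * (\sum_i d2u t' x' 0 i - \sum_i d2u (t' + s) x' 0 i).
      by rewrite -sumrB mulr_sumr; apply: eq_bigr => i _; rewrite !mxE; ring.
    rewrite ler_pM2l // !ueq //.
    have := KP _ _ (u01 t' cx') (u01 (t' + s) cx').
    rewrite [`|u t' x' - _|]gtr0_norm; last by lra.
    by rewrite ler_norml; lra.
  - move=> t' x' _ bx' _.
    have -> : edot (outward_normal h x')
          (expR (- K * (t' - T)) *: (du t' x' + -1 *: du (t' + s) x')) =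
        expR (- K * (t' - T)) * (edot (outward_normal h x') (du t' x') -
          edot (outward_normal h x') (du (t' + s) x')).
      by rewrite /edot -sumrB mulr_sumr; apply: eq_bigr => i _; rewrite !mxE; ring.
    by rewrite !ubd // subrr mulr0.
by rewrite pmulr_rle0 //; lra.
Qed.

Lemma front_like_homo (t t' : R) (x : V) : t <= t' -> closure (funnel h) x -> u t x <= u t' x.
Proof.
move=> tt' cx; rewrite -[t'](subrK t) addrC.
by apply: front_like_nondecreasing => //; rewrite subr_ge0.
Qed.

(** At a very negative time u >= 1/2 far to the left, and f(u) >= -K u because f(0) = 0. Positivity
    one unit of time later persists by monotonicity. *)
Lemma front_like_gt0 (t : R) (x : V) : closure (funnel h) x -> 0 < u t x.
Proof.
move=> cx; have [hcl _ _] := hu.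
have [ut [du [d2u [ureg ueq ubd]]]] := classical_solution_regular hcl.
have [K K0 KP] := bistable_lipschitz hf.
have e0 : 0 < 4^-1 :> R by rewrite invr_gt0.
have [T TP] := front_like_near_front e0.
have [A AP] := front_near_ninfty hphi e0.
pose t0 := Num.min T (t - 1).
have [t0T t0t] : t0 <= T /\ t0 <= t - 1 by rewrite !ge_min !lexx orbT.
have t0t1 : t0 + 1 <= t by lra.
apply: lt_le_trans (front_like_homo t0t1 cx).
have f0 : f 0 = 0 by case: hf => _ [].
apply: (half_space_positivity (dl := 2^-1) (A := A + c * t0) hrad halpha hh ureg K0) => //.
- by move=> t' x' _ /(u01 t') /andP[].
- move=> t' x' _ Ox'; rewrite ueq // lerD2l.
  have cx' := funnel_closure Ox'; have /andP[u0 u1] := u01 t' cx'.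
  have := KP _ 0 (u01 t' cx') (ltac:(lra)).
  by rewrite f0 !subr0 ler_norml (ger0_norm u0) => /andP[].
- by move=> t' x' _ bx'; rewrite ubd.
left => y cy yA; have := TP t0 y t0T cy.
have yA' : fstc y - c * t0 <= A by lra.
by have := AP _ yA'; rewrite ler_norml; lra.
Qed.

Hypothesis hblocked : blocked h u.

Lemma blocked_bound (eps : R) : 0 < eps -> exists A, forall t x,
  closure (funnel h) x -> A <= fstc x -> u t x <= eps.
Proof.
move=> e0; case: hblocked => uinf [ulim uinf0].
have e20 : 0 < eps / 2 by rewrite divr_gt0.
have [A AP] := uinf0 _ e20; exists A => t x cx Ax.
have K1 : compact [set x] by exact: compact_set1.
have K2 : [set x] `<=` closure (funnel h) by move=> _ ->.
have [M [_ MP]] := ulim _ K1 K2 _ e20.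
pose t' := Num.max t (M + 1).
have [tt' Mt'] : t <= t' /\ M + 1 <= t' by rewrite !le_max !lexx orbT.
have Mt1 : M < t' by lra.
have := MP t' Mt1 x erefl; have := AP x cx Ax; have := front_like_homo tt' cx.
by rewrite !ler_norml; lra.
Qed.

(** The same argument for 1 - u, started at time t - 1: blocking gives 1 - u >= 1/2 far to the right
    at every time. *)
Lemma front_like_lt1 (t : R) (x : V) : closure (funnel h) x -> u t x < 1.
Proof.
move=> cx; have [hcl _ _] := hu.
have [ut [du [d2u [ureg ueq ubd]]]] := classical_solution_regular hcl.
have [K K0 KP] := bistable_lipschitz hf.
have e0 : 0 < 2^-1 :> R by rewrite invr_gt0.
have [A AP] := blocked_bound e0.
have f1 : f 1 = 0 by case: hf => _ [].
have one := @regular_quadratic R n (funnel h) (fun=> 0) 0 1 0.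
have Wreg := regular_addZ (- 1) one ureg.
have sum0 (y : V) : \sum_i 0 * (y 0 i - (0 : V) 0 i) ^+ 2 = 0 :> R.
  by rewrite big1 // => i _; rewrite mul0r.
have WE (t' : R) (y : V) : 1 + 0 * t' - \sum_i 0 * (y 0 i - (0 : V) 0 i) ^+ 2 + -1 * u t' y =
    1 - u t' y by rewrite sum0; ring.
have -> : t = (t - 1) + 1 by rewrite subrK.
rewrite -subr_gt0 -WE.
apply: (half_space_positivity (dl := 2^-1) (A := A) hrad halpha hh Wreg K0) => //.
- by move=> t' x' _ cx'; rewrite WE subr_ge0; have /andP[] := u01 t' cx'.
- move=> t' x' _ Ox'; have cx' := funnel_closure Ox'.
  have -> : \sum_i (\row_i (- 2 * 0) + -1 *: d2u t' x') 0 i = - \sum_i d2u t' x' 0 i.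
    by rewrite -sumrN; apply: eq_bigr => i _; rewrite !mxE; ring.
  have /andP[u0 u1] := u01 t' cx'.
  have := KP _ 1 (u01 t' cx') (ltac:(lra)); rewrite f1 subr0 [`|u t' x' - 1|]distrC.
  rewrite (ger0_norm (x := 1 - _)) ?subr_ge0 // ler_norml WE ueq //.
  by lra.
- move=> t' x' _ bx'.
  rewrite [leRHS](_ : _ = - edot (outward_normal h x') (du t' x')); first by rewrite ubd // oppr0.
  by rewrite /edot -sumrN; apply: eq_bigr => i _; rewrite !mxE; ring.
by right => y cy yA; rewrite WE; have := AP (t - 1) y cy yA; lra.
Qed.

Lemma front_like_localization (eps : R) : 0 < eps -> exists2 M : R, 0 < M &
  forall t x, closure (funnel h) x ->
    (c * Num.min t 0 + M <= fstc x -> u t x <= eps) /\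
    (fstc x <= c * Num.min t 0 - M -> 1 - eps <= u t x).
Proof.
move=> e0; have e20 : 0 < eps / 2 by rewrite divr_gt0.
have [T' TP'] := front_like_near_front e20.
pose T := Num.min T' 0.
have [TT' T0] : T <= T' /\ T <= 0 by rewrite !ge_min !lexx orbT.
have TP t x : t <= T -> closure (funnel h) x -> `|u t x - phi (fstc x - c * t)| <= eps / 2.
  by move=> tT; apply: TP'; lra.
have [A1 A1P] := front_near_pinfty hphi e20.
have [A2 A2P] := front_near_ninfty hphi e20.
have [A AP] := blocked_bound e0.
have cT : c * T <= 0 by rewrite pmulr_rle0.
(* The term - c T covers the displacement of c min(t, 0) after T. For these times the bound on the
   right comes from blocking, and the one on the left from the state at T. *)
exists (1 + `|A1| + `|A2| + `|A| - c * T).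
  have := normr_ge0 A1; have := normr_ge0 A2; have := normr_ge0 A; lra.
have n1 := ler_norm A1; have n2 := ler_norm (- A2); have n3 := ler_norm A.
have p1 := normr_ge0 A1; have p2 := normr_ge0 A2; have p3 := normr_ge0 A.
rewrite normrN in n2.
move=> t x cx; have [tT|/ltW Tt] := leP t T.
  have t0 : t <= 0 by lra.
  rewrite min_l //; have := TP t x tT cx; rewrite ler_norml => h1; split=> hx.
    have zA : A1 <= fstc x - c * t by lra.
    by have := A1P _ zA; lra.
  have zA : fstc x - c * t <= A2 by lra.
  by have := A2P _ zA; lra.
have m0 : c * Num.min t 0 <= 0 by rewrite pmulr_rle0 // ge_min lexx orbT.
have m1 : c * T <= c * Num.min t 0 by rewrite ler_pM2l // le_min Tt T0.
split=> hx; first by apply: AP => //; lra.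
apply: le_trans (front_like_homo Tt cx).
have := TP T x (lexx T) cx; rewrite ler_norml => h1.
have zA : fstc x - c * T <= A2 by lra.
by have := A2P _ zA; lra.
Qed.

End FrontLike.

(** * Transition front families *)

(** Exchanging the first and last coordinates has determinant -1; a change of sign of one coordinate
    makes it a rotation. *)
Lemma rotation_first_to_last (R : realType) (n : nat) : (0 < n)%N ->
  exists2 Q : 'M[R]_n.+1, rotation Q & forall j, Q ord_max j = (j == ord0)%:R.
Proof.
move=> n0; have max0 : (ord_max : 'I_n.+1) != ord0 by rewrite -val_eqE /= -lt0n.
pose s := tperm (ord0 : 'I_n.+1) ord_max.
pose d : 'rV[R]_n.+1 := \row_i (if i == ord0 then -1 else 1).
exists (diag_mx d *m perm_mx s).
  split.
    rewrite trmx_mul tr_diag_mx tr_perm_mx mulmxA -[_ *m _ *m perm_mx _]mulmxA.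
    rewrite -perm_mxM mulgV perm_mx1 mulmx1 mul_diag_mx.
    apply/matrixP => i j; rewrite !mxE; case: (eqVneq i j) => [->|ij] /=.
      by rewrite mulr1n; case: ifP => _; rewrite ?mulrNN mulr1.
    by rewrite mulr0n mulr0.
  rewrite det_mulmx det_diag det_perm odd_tperm eq_sym max0 expr1.
  rewrite big_ord_recl mxE eqxx big1 ?mulr1 ?mulrNN ?mulr1 //.
  by move=> i _; rewrite mxE.
move=> j; rewrite mul_diag_mx !mxE (negbTE max0) mul1r /s tpermR.
by rewrite eq_sym.
Qed.

Section Families.
Variables (R : realType) (n : nat) (rad alpha : R) (h : R -> R).
Hypothesis hh : funnel_profile rad alpha h.
Notation V := 'rV[R]_n.+1.
Notation Omega := (funnel h : set V).

Let hc := profile_continuous hh.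
Let h0 := profile_gt0 hh.

Definition section_at (s : R) : set V := [set x | Omega x /\ fstc x = s].
Definition left_of (s : R) : set V := [set x | Omega x /\ fstc x < s].
Definition right_of (s : R) : set V := [set x | Omega x /\ s < fstc x].

Lemma axis_section (s : R) : section_at s (mkpoint s 0).
Proof. by split; [exact: funnel_axis|exact: fstc_mkpoint]. Qed.

Lemma enorm0 (k : nat) : enorm (0 : 'rV[R]_k) = 0.
Proof. by rewrite -(scale0r 0) enormZ normr0 mul0r. Qed.

Lemma geo_dist_section_ge (s : R) (x : V) :
  (`|fstc x - s|%:E <= geo_dist_set Omega x (section_at s))%E.
Proof. by apply: le_ereal_inf_tmp => _ [y [_ <-] <-]; exact: geo_dist_ge_fst. Qed.

Lemma geo_dist_section_le (s : R) (x : V) : closure Omega x ->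
  (geo_dist_set Omega x (section_at s) <=
   (3 * (`|fstc x - s| + n%:R * enorm (sndc x)))%:E)%E.
Proof.
move=> cx; apply: (@le_trans _ _ (geo_dist Omega x (mkpoint s 0))).
  by apply: ereal_inf_lbound; exists (mkpoint s 0) => //; exact: axis_section.
apply: le_trans (geo_dist_le hc h0 cx (funnel_closure (axis_section s).1)) _.
by rewrite fstc_mkpoint sndc_mkpoint enorm0 addr0.
Qed.

Lemma closure_left_of (s : R) (x : V) : closure (left_of s) x ->
  closure Omega x /\ fstc x <= s.
Proof.
move=> cx; split; first by apply: closure_subset cx => y [].
have cl : closed (@fstc R n @^-1` [set r | r <= s]).
  by apply: preimage_closed => [y _|]; [exact: continuous_fstc|exact: closed_le].
suff : closure (left_of s) `<=` (@fstc R n @^-1` [set r | r <= s]) by exact.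
rewrite [X in _ `<=` X]((closure_id _).1 cl).
by apply: closure_subset => y [_ /ltW].
Qed.

Lemma closure_right_of (s : R) (x : V) : closure (right_of s) x ->
  closure Omega x /\ s <= fstc x.
Proof.
move=> cx; split; first by apply: closure_subset cx => y [].
have cl : closed (@fstc R n @^-1` [set r | s <= r]).
  by apply: preimage_closed => [y _|]; [exact: continuous_fstc|exact: closed_ge].
suff : closure (right_of s) `<=` (@fstc R n @^-1` [set r | s <= r]) by exact.
rewrite [X in _ `<=` X]((closure_id _).1 cl).
by apply: closure_subset => y [_ /ltW].
Qed.

Lemma open_left_of (s : R) : open (left_of s).
Proof.
apply: openI; first exact: open_funnel.
by apply: (@open_comp _ _ (@fstc R n) [set r | r < s]) => [y _|];
  [exact: continuous_fstc|exact: open_lt].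
Qed.

Lemma open_right_of (s : R) : open (right_of s).
Proof.
apply: openI; first exact: open_funnel.
by apply: (@open_comp _ _ (@fstc R n) [set r | s < r]) => [y _|];
  [exact: continuous_fstc|exact: open_gt].
Qed.

Lemma near_axis_shift (B : set V) (x : V) : Omega x -> nbhs x B ->
  exists2 r : R, 0 < r & forall a, `|a| <= r ->
    (Omega `&` B) (x + a *: basis_vec R ord0).
Proof.
move=> Ox xB; have : nbhs x (Omega `&` B).
  by apply: filterI => //; apply: open_nbhs_nbhs; split => //; exact: open_funnel.
move=> /nbhs_ballP[e /= e0 eB]; exists (e / 2); first by rewrite divr_gt0.
move=> a ae; apply: eB; rewrite -ball_normE /= opprD addNKr normrN.
apply: (@le_lt_trans _ _ `|a|); last by lra.
apply: rV_norm_le => // j; rewrite !mxE eqxx /= normrM ler_piMr //.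
by case: (j == ord0); rewrite ?normr1 ?normr0.
Qed.

Lemma fstc_shift (x : V) (a : R) : fstc (x + a *: basis_vec R ord0) = fstc x + a.
Proof. by rewrite /fstc !mxE !eqxx mulr1. Qed.

Lemma bdry_left_of (s : R) : bdry (left_of s) `&` Omega = section_at s.
Proof.
have oL := (interior_id _).1 (@open_left_of s).
apply/seteqP; split=> x; rewrite /bdry oL.
  move=> [[/closure_left_of[_ xs] nx] Ox]; split=> //.
  by apply/eqP; rewrite eq_le xs leNgt; apply/negP => sx; apply: nx.
move=> [Ox xs]; split=> //; split; last by move=> [_]; rewrite xs ltxx.
move=> B /(near_axis_shift Ox)[r r0 rB].
have [|O1 B1] := rB (- r); first by rewrite normrN gtr0_norm.
exists (x + (- r) *: basis_vec R ord0); split=> //; split=> //.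
by rewrite fstc_shift xs; lra.
Qed.

Lemma bdry_right_of (s : R) : bdry (right_of s) `&` Omega = section_at s.
Proof.
have oL := (interior_id _).1 (@open_right_of s).
apply/seteqP; split=> x; rewrite /bdry oL.
  move=> [[/closure_right_of[_ xs] nx] Ox]; split=> //.
  by apply/eqP; rewrite eq_le xs andbT leNgt; apply/negP => sx; apply: nx.
move=> [Ox xs]; split=> //; split; last by move=> [_]; rewrite xs ltxx.
move=> B /(near_axis_shift Ox)[r r0 rB].
have [|O1 B1] := rB r; first by rewrite gtr0_norm.
exists (x + r *: basis_vec R ord0); split=> //; split=> //.
by rewrite fstc_shift xs; lra.
Qed.

Lemma left_of_axis (s a : R) : 0 < a -> left_of s (mkpoint (s - a) 0).
Proof. by move=> a0; split; [exact: funnel_axis|rewrite fstc_mkpoint; lra]. Qed.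

Lemma right_of_axis (s a : R) : 0 < a -> right_of s (mkpoint (s + a) 0).
Proof. by move=> a0; split; [exact: funnel_axis|rewrite fstc_mkpoint; lra]. Qed.

Lemma axis_far_from_section (s a b : R) : 0 < a -> `|b| = a ->
  (a%:E <= geo_dist_set Omega (mkpoint (s + b) 0) (section_at s))%E.
Proof.
move=> a0 ba; apply: le_trans (geo_dist_section_ge _ _).
by rewrite fstc_mkpoint addrAC subrr add0r ba.
Qed.

(** * Admissibility of the families given by vertical sections *)

Lemma front_partition_sections (xi : R -> R) :
  front_partition Omega (fun t => right_of (xi t)) (fun t => left_of (xi t))
    (fun t => section_at (xi t)).
Proof.
move=> t; set s := xi t; split.
- split; [exact: open_right_of| |by move=> x []].
  by exists (mkpoint (s + 1) 0); exact: right_of_axis.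
- split; [exact: open_left_of| |by move=> x []].
  by exists (mkpoint (s - 1) 0); exact: left_of_axis.
- split; [|exact: bdry_right_of|exact: bdry_left_of| |].
  + by apply/seteqP; split=> x // -[[_ x1] [_ x2]]; move: x1 x2; lra.
  + by exists (mkpoint s 0); exact: axis_section.
  + apply/seteqP; split=> x; first by move=> [[[]|[]]|[]].
    move=> Ox; case: (ltgtP (fstc x) s) => xs; [right|left; left|left; right]; by split.
- apply/eqyP => a a0; apply: (le_trans (@axis_far_from_section s a (- a) a0 _)).
    by rewrite normrN gtr0_norm.
  by apply: ereal_sup_ubound; exists (mkpoint (s - a) 0) => //; exact: left_of_axis.
- apply/eqyP => a a0; apply: (le_trans (@axis_far_from_section s a a a0 _)).
    by rewrite gtr0_norm.
  by apply: ereal_sup_ubound; exists (mkpoint (s + a) 0) => //; exact: right_of_axis.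
Qed.

(** The sign b selects the side. As xi <= 0, every section has radius [rad], so an axis point at
    depth a is within 3 (a + n rad) of all points of the section, uniformly in t. *)
Lemma front_depth_sections (xi : R -> R) (b : R) (O : R -> set V) :
  (forall t, xi t <= 0) -> `|b| = 1 ->
  (forall t a, 0 < a -> O t (mkpoint (xi t + b * a) 0)) ->
  front_depth Omega O (fun t => section_at (xi t)).
Proof.
move=> xi0 b1 OP; apply/cvgeyPge => A.
pose a := `|A| + 1; have a0 : 0 < a by rewrite ltr_wpDl.
exists (3 * (a + n%:R * rad)); split; first exact: num_real.
move=> r rA; apply: le_ereal_inf_tmp => _ [[t x] /= [Ox xs] <-].
have ba : `|b * a| = a by rewrite normrM b1 mul1r gtr0_norm.
apply: (@le_trans _ _ a%:E); first by rewrite lee_fin ler_wpDr // ler_norm.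
apply: (le_trans (@axis_far_from_section (xi t) a (b * a) a0 ba)).
apply: ereal_sup_ubound; exists (mkpoint (xi t + b * a) 0) => //=; split; first exact: OP.
have co : closure Omega (mkpoint (xi t + b * a) 0) by apply: funnel_closure; exact: funnel_axis.
apply: le_trans (geo_dist_le hc h0 co (funnel_closure Ox)) _.
rewrite lee_fin fstc_mkpoint sndc_mkpoint enorm0 add0r xs addrAC subrr add0r ba.
apply: le_trans (ltW rA); rewrite ler_wpM2l // lerD2l ler_wpM2l //.
have hx : h (fstc x) = rad by rewrite xs; case: hh => _ _ _ + _; exact.
by rewrite -hx ltW.
Qed.

Lemma front_graphs_sections (xi : R -> R) : (0 < n)%N ->
  front_graphs (fun t => section_at (xi t)).
Proof.
move=> n0; exists 1%N => // t.
have [Q Qrot Qmax] := rotation_first_to_last R n0.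
exists (fun=> setT), (fun=> fun=> xi t), (fun=> Q); split.
- by move=> _; split; [exact: openT|apply: continuous_subspaceT; exact: cst_continuous].
- by [].
- move=> x [_ xs]; exists ord0 => //; exists (x *m Q^T).
    split=> //; rewrite mxE (bigD1 ord0) //= mxE Qmax eqxx mulr1 big1 ?addr0 //.
    by move=> j j0; rewrite mxE Qmax (negbTE j0) mulr0.
  by rewrite -mulmxA (mulmx1C Qrot.1) mulmx1.
Qed.

(** Being far from the section must mean that |x_1 - xi| is large. For x_1 <= M the cross-sections
    have radius at most h(M), so this holds; for x_1 > M it is immediate from xi <= 0. *)
Lemma front_limits_sections (u : R -> V -> R) (xi : R -> R) : (forall t, xi t <= 0) ->
  (forall eps : R, 0 < eps -> exists2 M : R, 0 < M & forall t x, closure Omega x ->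
    (xi t + M <= fstc x -> u t x <= eps) /\ (fstc x <= xi t - M -> 1 - eps <= u t x)) ->
  front_limits Omega (fun t => right_of (xi t)) (fun t => left_of (xi t))
    (fun t => section_at (xi t)) u.
Proof.
move=> xi0 loc eps /loc[M M0 MP].
have n0 : 0 <= n%:R * h M by rewrite mulr_ge0 // ltW.
exists (3 * (M + n%:R * h M)); first by rewrite mulr_gt0 // ltr_wpDr.
move=> t x far.
have close : closure Omega x -> fstc x <= M -> M <= `|fstc x - xi t|.
  move=> cx xM; rewrite leNgt; apply/negP => near.
  have := le_trans far (geo_dist_section_le (xi t) cx).
  rewrite lee_fin ler_pM2l // leNgt => /negP; apply.
  rewrite ltr_leD // ler_wpM2l //.
  move: cx; rewrite (closure_funnel n hc h0) /= => /le_trans; apply.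
  exact: (profile_nondecreasing hh).
have xit := xi0 t; split.
  move=> /closure_left_of[cx xs]; apply: (MP t x cx).2.
  have xM : fstc x <= M by lra.
  have := close cx xM; rewrite ler0_norm; lra.
move=> /closure_right_of[cx xs]; apply: (MP t x cx).1.
have [xM|Mx] := leP (fstc x) M; last by lra.
by have := close cx xM; rewrite ger0_norm; lra.
Qed.

Lemma front_families_sections (u : R -> V -> R) (xi : R -> R) : (0 < n)%N ->
  (forall t, xi t <= 0) ->
  (forall eps : R, 0 < eps -> exists2 M : R, 0 < M & forall t x, closure Omega x ->
    (xi t + M <= fstc x -> u t x <= eps) /\ (fstc x <= xi t - M -> 1 - eps <= u t x)) ->
  front_families Omega u (fun t => right_of (xi t)) (fun t => left_of (xi t))
    (fun t => section_at (xi t)).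
Proof.
move=> n0 xi0 loc; split.
- exact: front_partition_sections.
- split; [apply: (front_depth_sections (b := 1)) => //|
          apply: (front_depth_sections (b := -1)) => //].
  + by rewrite normr1.
  + by move=> t a a0; rewrite mul1r; exact: right_of_axis.
  + by rewrite normrN normr1.
  + by move=> t a a0; rewrite mulN1r; exact: left_of_axis.
- exact: front_graphs_sections.
- exact: front_limits_sections.
Qed.

(* The depth condition gives, near every point of Gamma_t, points of Omega^+_t
   and Omega^-_t where u is close to 1 and to 0. *)
Lemma families_near_transition (u : R -> V -> R) (xi : R -> R) (M0 : R)
    (Om Op G : R -> set V) :
  (forall t x, closure Omega x ->
    (xi t + M0 <= fstc x -> u t x <= 4^-1) /\ (fstc x <= xi t - M0 -> 1 - 4^-1 <= u t x)) ->
  front_families Omega u Om Op G ->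
  exists2 C : R, 0 <= C & forall t z, G t z -> `|fstc z - xi t| <= C.
Proof.
move=> loc [part [dm dp] _ lim].
have [M M_gt0 MP] := lim 4^-1 (ltac:(lra)).
have find (O : R -> set V) : front_depth Omega O G -> exists2 r : R, 0 <= r &
    forall t z, G t z -> exists y, [/\ O t y, `|fstc y - fstc z| <= r &
      (M%:E <= geo_dist_set Omega y (G t))%E].
  move=> /cvgeyPge /(_ (M + 1)) [r0 [_ r0P]].
  pose r := Num.max r0 0 + 1.
  have [rr0 rr1] : r0 < r /\ 0 <= r.
    have : r0 <= Num.max r0 0 /\ 0 <= Num.max r0 0 by rewrite !le_max !lexx orbT.
    by rewrite /r; lra.
  exists r => // t z Gz; have := r0P r rr0 => inf_ge.
  have : (M%:E < ereal_sup [set geo_dist_set Omega y (G t) |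
      y in [set y | O t y /\ (geo_dist Omega y z <= r%:E)%E]])%E.
    apply: (@lt_le_trans _ _ (M + 1)%:E); first by rewrite lte_fin ltrDl ltr01.
    by apply: le_trans inf_ge _; apply: ereal_inf_lbound; exists (t, z).
  move=> /ereal_sup_gt[_ [y [Oy yz] <-] /ltW My]; exists y; split=> //.
  by rewrite -lee_fin; apply: le_trans yz; exact: geo_dist_ge_fst.
have [rm rm0 rmP] := find Om dm; have [rp rp0 rpP] := find Op dp.
exists (`|M0| + rm + rp); first by rewrite !addr_ge0.
move=> t z Gz; have nM := ler_norm M0.
have [ym [Oym yzm farm]] := rmP t z Gz; have [yp [Oyp yzp farp]] := rpP t z Gz.
have [[_ _ Omsub] [_ _ Opsub] _ _ _] := part t.
have um : u t ym <= 4^-1 := (MP t ym farm).2 (subset_closure Oym).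
have up : 1 - 4^-1 <= u t yp := (MP t yp farp).1 (subset_closure Oyp).
(* A value at most 1/4 excludes the region on the left, and a value at least 3/4 the region on the
   right; z is close to both points, hence bounded on both sides. *)
have lm : xi t - M0 < fstc ym.
  rewrite ltNge; apply/negP => /(loc t ym (funnel_closure (Omsub _ Oym))).2; lra.
have lp : fstc yp < xi t + M0.
  rewrite ltNge; apply/negP => /(loc t yp (funnel_closure (Opsub _ Oyp))).1; lra.
by move: yzm yzp; rewrite !ler_norml; lra.
Qed.

(** * Incompatible mean speeds before and after time 0 *)

Lemma speed_quotient (d : \bar R) (L gamma eps : R) : 0 < L -> (0 <= d)%E ->
  (`|d * (L^-1)%:E - gamma%:E| <= eps%:E)%E ->
  exists2 r : R, d = r%:E & `|r / L - gamma| <= eps.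
Proof.
move=> L0; case: d => [r _|_|//]; first by rewrite -EFinM -EFinB abse_EFin lee_fin; exists r.
by rewrite gt0_mulye ?lte_fin ?invr_gt0.
Qed.

Lemma no_global_mean_speed (u : R -> V -> R) (xi : R -> R) (c M0 gamma : R) :
  0 < c -> (forall t, t <= 0 -> xi t = c * t) -> (forall t, 0 < t -> xi t = 0) ->
  (forall t x, closure Omega x ->
    (xi t + M0 <= fstc x -> u t x <= 4^-1) /\ (fstc x <= xi t - M0 -> 1 - 4^-1 <= u t x)) ->
  ~ global_mean_speed h u gamma.
Proof.
move=> c0 xineg xipos loc [Om [Op [G [fam spd]]]].
have [C C0 CP] := families_near_transition loc fam.
have [part _ _ _] := fam.
have GO t x : G t x -> Omega x.
  by move=> Gx; have [_ _ [_ _ _ _ <-] _ _] := part t; left; right.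
have Gne t : G t !=set0 by have [_ _ []] := part t.
have e0 : 0 < c / 8 by rewrite divr_gt0.
have [T TP] := spd _ e0.
(* At positive times the interfaces lie in |x_1| <= C, where |x'| <= h(C); this bounds their mutual
   geodesic distance. *)
pose D := 3 * (2 * C + n%:R * (2 * h C)).
have hC := h0 C.
have D0 : 0 <= D by rewrite mulr_ge0 // addr_ge0 // ?mulr_ge0 // ltW.
(* The pairs (-2L, -L) and (L, 2L) have the same time gap. Their distances differ by at least c L -
   2 C - D >= 3 c L / 4, while a common speed up to c / 8 allows at most c L / 4. *)
pose L := `|T| + 1 + 4 * (2 * C + D) / c.
have q0 : 0 <= 4 * (2 * C + D) / c by rewrite divr_ge0 // ?(ltW c0) // mulr_ge0 //; lra.
have TL : T <= L by have := ler_norm T; rewrite /L; lra.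
have L0 : 0 < L by have := normr_ge0 T; rewrite /L; lra.
have cL : 4 * (2 * C + D) <= c * L.
  have : 4 * (2 * C + D) / c <= L by have := normr_ge0 T; rewrite /L; lra.
  by rewrite ler_pdivrMr // [L * c]mulrC.
have dist_ge0 A B : (0 <= geo_dist_sets Omega A B)%E.
  apply: le_ereal_inf_tmp => _ [x _ <-]; apply: le_ereal_inf_tmp => _ [y _ <-].
  by apply: le_trans (geo_dist_ge_fst Omega x y); rewrite lee_fin.
have quot t s : `|t - s| = L -> exists2 r : R, geo_dist_sets Omega (G t) (G s) = r%:E &
    `|r / L - gamma| <= c / 8.
  move=> tsL; apply: speed_quotient => //.
  by have := TP t s; rewrite tsL => /(_ L0 TL).
have [|r1 r1E r1P] := quot (- L) (- (2 * L)).
  by rewrite (_ : - L - - (2 * L) = L) ?gtr0_norm //; ring.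
have [|r2 r2E r2P] := quot (2 * L) L.
  by rewrite (_ : 2 * L - L = L) ?gtr0_norm //; ring.
have r1ge : c * L - 2 * C <= r1.
  rewrite -lee_fin -r1E; apply: le_ereal_inf_tmp => _ [x Gx <-].
  apply: le_ereal_inf_tmp => _ [y Gy <-].
  apply: le_trans (geo_dist_ge_fst Omega x y); rewrite lee_fin.
  have := CP _ _ Gx; have := CP _ _ Gy; rewrite !xineg; [|lra|lra].
  have := ler_norm (fstc x - fstc y).
  by rewrite !ler_norml !mulrN; lra.
have r2le : r2 <= D.
  rewrite -lee_fin -r2E.
  have [x Gx] := Gne (2 * L); have [y Gy] := Gne L.
  apply: (@le_trans _ _ (geo_dist Omega x y)).
    apply: (@le_trans _ _ (geo_dist_set Omega x (G L))); apply: ereal_inf_lbound.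
      by exists x.
    by exists y.
  have cx := funnel_closure (GO _ _ Gx); have cy := funnel_closure (GO _ _ Gy).
  apply: le_trans (geo_dist_le hc h0 cx cy) _; rewrite lee_fin /D ler_wpM2l //.
  have := CP _ _ Gx; have := CP _ _ Gy; rewrite !xipos; [|lra|lra].
  rewrite !subr0 => yC xC; apply: lerD.
    by apply: le_trans (ler_normB _ _) _; lra.
  rewrite ler_wpM2l //.
  have bound z : closure Omega z -> `|fstc z| <= C -> enorm (sndc z) <= h C.
    rewrite (closure_funnel n hc h0) /= => /le_trans cz zC; apply: cz.
    by apply: (profile_nondecreasing hh); exact: le_trans (ler_norm _) zC.
  by have := bound x cx xC; have := bound y cy yC; lra.
have Q1 : r1 / L * L = r1 by rewrite divfK // gt_eqF.
have Q2 : r2 / L * L = r2 by rewrite divfK // gt_eqF.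
have : (r1 / L - r2 / L) * L <= c / 4 * L.
  by rewrite ler_pM2r //; move: r1P r2P; rewrite !ler_norml; lra.
have : 0 < c * L by rewrite mulr_gt0.
rewrite mulrBl Q1 Q2; lra.
Qed.

End Families.

Theorem theorem1p7 (R : realType) (n : nat) (hn : (2 <= n.+1)%N)
  (f : R -> R) (theta : R) (hf : bistable f theta)
  (c : R) (phi : R -> R) (hphi : planar_front f theta c phi)
  (rad alpha : R) (hrad : 0 < rad) (halpha : 0 < alpha < pi / 2)
  (h : R -> R) (hh : funnel_profile rad alpha h)
  (u : R -> 'rV[R]_n.+1 -> R) (hu : front_like_solution f c phi h u)
  (hblocked : blocked h u) :
  [/\ transition_front f h u,
      ~ (exists2 gamma : R, 0 <= gamma & global_mean_speed h u gamma) &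
      front_families (funnel h) u
        (fun t => if t <= 0 then [set x | funnel h x /\ - (fstc x - c * t) < 0]
                  else [set x | funnel h x /\ - fstc x < 0])
        (fun t => if t <= 0 then [set x | funnel h x /\ fstc x - c * t < 0]
                  else [set x | funnel h x /\ fstc x < 0])
        (fun t => if t <= 0 then [set x | funnel h x /\ fstc x = c * t]
                  else [set x | funnel h x /\ fstc x = 0])].
Proof.
have c0 := front_speed_gt0 hf hphi.
pose xi (t : R) := c * Num.min t 0.
have xi_neg t : t <= 0 -> xi t = c * t by move=> t0; rewrite /xi min_l.
have xi_pos t : 0 < t -> xi t = 0.
  by move=> t0; rewrite /xi min_r ?mulr0 // ltW.
have xi0 t : xi t <= 0 by rewrite pmulr_rle0 // ge_min lexx orbT.
have loc := front_like_localization hf hphi hrad halpha hh hu hblocked.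
have fam := @front_families_sections R n rad alpha h hh u xi hn xi0 loc.
have [M0 _ loc4] := loc 4^-1 (ltac:(lra)).
have [hcl _ _] := hu.
have OmE : (fun t => if t <= 0 then [set x | funnel h x /\ - (fstc x - c * t) < 0]
    else [set x | funnel h x /\ - fstc x < 0]) =
    (fun t => right_of h (xi t) : set 'rV[R]_n.+1).
  apply/funext => t; case: (leP t 0) => t0.
    by rewrite xi_neg //; apply/seteqP; split=> x [Ox /= xt]; split=> //=; lra.
  by rewrite xi_pos //; apply/seteqP; split=> x [Ox /= xt]; split=> //=; lra.
have OpE : (fun t => if t <= 0 then [set x | funnel h x /\ fstc x - c * t < 0]
    else [set x | funnel h x /\ fstc x < 0]) =
    (fun t => left_of h (xi t) : set 'rV[R]_n.+1).
  apply/funext => t; case: (leP t 0) => t0.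
    by rewrite xi_neg //; apply/seteqP; split=> x [Ox /= xt]; split=> //=; lra.
  by rewrite xi_pos //; apply/seteqP; split=> x [Ox /= xt]; split=> //=; lra.
have GE : (fun t => if t <= 0 then [set x | funnel h x /\ fstc x = c * t]
    else [set x | funnel h x /\ fstc x = 0]) =
    (fun t => section_at h (xi t) : set 'rV[R]_n.+1).
  by apply/funext => t; case: (leP t 0) => t0; [rewrite xi_neg|rewrite xi_pos].
split; last by rewrite OmE OpE GE.
  split=> //; last by exists (fun t => right_of h (xi t)), (fun t => left_of h (xi t)),
    (fun t => section_at h (xi t)).
  move=> t x cx; rewrite (front_like_gt0 hf hphi hrad halpha hh hu t cx).
  exact: (front_like_lt1 hf hphi hrad halpha hh hu hblocked t cx).
by move=> [gamma _] /(no_global_mean_speed hh c0 xi_neg xi_pos loc4).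
Qed.
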